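(* Let $\delta_n\to0^+$ as $n\to\infty$. Then $E_{\delta_n}$ $\Gamma$-converges to $F$ in the weak topology of $A$, i.e.: (i) for every $\xi^*\in A$ and every sequence $\{\xi_n\}\subset A$ converging weakly to $\xi^*$ in $A$, $\liminf_{n\to\infty}E_{\delta_n}[\xi_n]\ge F[\xi^*]$; (ii) for every $\xi^*\in A$ there is a sequence $\{\xi_n\}\subset A$ converging weakly to $\xi^*$ in $A$ with $\limsup_{n\to\infty}E_{\delta_n}[\xi_n]\le F[\xi^*]$.
   Context: Let $w:\mathbb{R}\to\mathbb{R}$ be a function with continuous third derivative, periodic with period $1$, with $w(z)=0$ for all $z\in\mathbb{Z}$, $w(\xi)>0$ for $\xi\notin\mathbb{Z}$, $w''(z)>0$ for all $z\in\mathbb{Z}$, and $w(1-\xi)=w(\xi)$ for all $\xi$. Let $\bar v:\mathbb{R}\to\mathbb{R}$ be continuously differentiable and strictly increasing with $\bar v(x)\to0$ as $x\to-\infty$, $\bar v(x)\to1$ as $x\to\infty$, $1-\bar v\in L^1([0,\infty))\cap L^2([0,\infty))$, $\bar v\in L^1((-\infty,0])\cap L^2((-\infty,0])$, $\bar v'\in L^1(\mathbb{R})\cap L^2(\mathbb{R})$. Let $A=\{\xi:\xi-\bar v\in H^1(\mathbb{R})\}$; a sequence $\xi_n$ converges weakly to $\xi$ in $A$ if $\xi_n-\bar v\rightharpoonup\xi-\bar v$ weakly in $H^1(\mathbb{R})$. For $\delta>0$, $A_\delta$ is the set of continuous $\xi\in A$ that are affine on each interval $[(i-1)\delta,i\delta]$,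 $i\in\mathbb{Z}$. Define $E_\delta:A\to[0,\infty]$ by $E_\delta[\xi]=\int_{-\infty}^\infty\xi'(x)^2\,dx+\int_{-\infty}^\infty w(\xi(x))\,dx$ if $\xi\in A_\delta$ and $E_\delta[\xi]=\infty$ otherwise, and $F:A\to[0,\infty]$ by $F[\xi]=\int_{-\infty}^\infty\xi'(x)^2\,dx+\int_{-\infty}^\infty w(\xi(x))\,dx$. *)

(* Defs.v *)
From HB Require Import structures.
From mathcomp Require Import all_boot all_order all_algebra.
From mathcomp Require Import all_classical all_reals all_analysis.
Set Implicit Arguments. Unset Strict Implicit. Unset Printing Implicit Defensive.
Import Order.TTheory GRing.Theory Num.Theory.
Import numFieldNormedType.Exports.
Local Open Scope classical_set_scope.
Local Open Scope ring_scope.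

Section Defs.
Variable R : realType.
Local Notation leb := (@lebesgue_measure R).

Definition nderiv (k : nat) (f : R -> R) : R -> R := iter k (fun g => derive1 g) f.

Definition test_fun (phi : R -> R) : Prop :=
  (forall k x, derivable (nderiv k phi) x 1) /\
  (exists M : R, forall x, M < `|x| -> phi x = 0).

Definition loc_integrable (f : R -> R) : Prop :=
  measurable_fun setT f /\
  forall a b : R, leb.-integrable `[a, b] (fun x => (f x)%:E).

Definition is_weak_deriv (f g : R -> R) : Prop :=
  loc_integrable f /\ loc_integrable g /\
  forall phi, test_fun phi ->
    (\int[leb]_x (f x * derive1 phi x)%:E = - \int[leb]_x (g x * phi x)%:E)%E.

Definition L2_on (D : set R) (f : R -> R) : Prop :=
  measurable_fun D f /\ leb.-integrable D (fun x => (f x ^+ 2)%:E).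

Definition L1_on (D : set R) (f : R -> R) : Prop :=
  leb.-integrable D (fun x => (f x)%:E).

Definition H1 (f : R -> R) : Prop :=
  L2_on setT f /\ exists g, is_weak_deriv f g /\ L2_on setT g.

(** A chosen weak derivative (unique a.e. when it exists). *)
Definition wderiv (f : R -> R) : R -> R :=
  match pselect (exists g, is_weak_deriv f g) with
  | left H => projT1 (cid H)
  | right _ => fun _ => 0
  end.

Definition H1norm (f : R -> R) : R :=
  Num.sqrt (fine (\int[leb]_x (f x ^+ 2)%:E) +
            fine (\int[leb]_x (wderiv f x ^+ 2)%:E)).

Definition H1_dual (L : (R -> R) -> R) : Prop :=
  (forall (a : R) f g, H1 f -> H1 g -> L (fun x => a * f x + g x) = a * L f + L g) /\
  (exists C : R, forall f, H1 f -> `|L f| <= C * H1norm f).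

Definition H1_weak_cvg (u : nat -> R -> R) (f : R -> R) : Prop :=
  (forall n, H1 (u n)) /\ H1 f /\
  forall L, H1_dual L -> (fun n => L (u n)) @ \oo --> L f.

Definition w_hyp (w : R -> R) : Prop :=
  (forall k x, (k < 3)%N -> derivable (nderiv k w) x 1) /\
  continuous (nderiv 3 w) /\
  (forall x, w (x + 1) = w x) /\
  (forall z : int, w z%:~R = 0) /\
  (forall x, (forall z : int, x != z%:~R) -> 0 < w x) /\
  (forall z : int, 0 < nderiv 2 w z%:~R) /\
  (forall x, w (1 - x) = w x).

Definition vbar_hyp (vbar : R -> R) : Prop :=
  (forall x, derivable vbar x 1) /\ continuous (derive1 vbar) /\
  (forall x y, x < y -> vbar x < vbar y) /\
  (vbar x @[x --> -oo%R] --> (0:R)) /\ (vbar x @[x --> +oo%R] --> (1:R)) /\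
  L1_on `[0, +oo[ (fun x => 1 - vbar x) /\ L2_on `[0, +oo[ (fun x => 1 - vbar x) /\
  L1_on `]-oo, 0] vbar /\ L2_on `]-oo, 0] vbar /\
  L1_on setT (derive1 vbar) /\ L2_on setT (derive1 vbar).

Definition adm (vbar xi : R -> R) : Prop := H1 (fun x => xi x - vbar x).

Definition A_weak_cvg (vbar : R -> R) (u : nat -> R -> R) (xi : R -> R) : Prop :=
  H1_weak_cvg (fun n x => u n x - vbar x) (fun x => xi x - vbar x).

Definition adm_delta (vbar : R -> R) (delta : R) (xi : R -> R) : Prop :=
  adm vbar xi /\ continuous xi /\
  forall i : int, exists a b : R, forall x,
    x \in `[(i - 1)%:~R * delta, i%:~R * delta] -> xi x = a * x + b.

Definition energy (w : R -> R) (xi : R -> R) : \bar R :=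
  (\int[leb]_x (wderiv xi x ^+ 2)%:E + \int[leb]_x (w (xi x))%:E)%E.

Definition Fen (w : R -> R) (xi : R -> R) : \bar R := energy w xi.

Definition Eden (w vbar : R -> R) (delta : R) (xi : R -> R) : \bar R :=
  if `[< adm_delta vbar delta xi >] then energy w xi else (+oo)%E.

End Defs.

(* Main.v *)
(** Every [f] in [H^1] has a continuous representative with
    [f b - f a = \int_a^b f'], and point evaluation is a bounded functional on
    [H^1]; hence weak convergence in [A] gives pointwise convergence of the
    representatives. For (i), Fatou's lemma handles the potential and
    [(xi_n')^2 >= (xi')^2 + 2 xi' (xi_n' - xi')], whose last term integrates to
    a bounded functional, handles the gradient.

    For (ii), interpolate the continuous representative [xi] at the nodes
    [i delta]. By Cauchy-Schwarz on each cell, [|xi_n'|_2 <= |xi'|_2] and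
    [|xi_n - xi|_2 <= 2 delta |xi'|_2]. The slopes converge to [xi'] at the
    Lebesgue points of [xi'], which together with the norm bound yields strong
    convergence in [H^1]. Since [w >= 0] has bounded second derivative,
    [(w')^2 <= 4 M w], so
    [w a <= (1 + e M) w b + (1/e + M) (a - b)^2], and [e = delta] controls the
    potential energy. *)

Require Import Defs.
From HB Require Import structures.
From mathcomp Require Import all_boot all_order all_algebra.
From mathcomp Require Import all_classical all_reals all_analysis.
From mathcomp Require Import measurable_realfun ring lra.
Set Implicit Arguments.
Unset Strict Implicit.
Unset Printing Implicit Defensive.
Import Order.TTheory GRing.Theory Num.Theory.
Import numFieldNormedType.Exports.
Local Open Scope classical_set_scope.
Local Open Scope ring_scope.

(** * Smooth step functions *)


(** A weak derivative is tested only against smooth compactly supported functions, and [wderiv] is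
    an arbitrary choice, so nothing is known about it pointwise. The bridge to values of the
    function is a smooth step built by hand from exp(-1/x). The derivative of a rescaled step is an
    approximate identity at every Lebesgue point, while the difference of two steps approximates the
    indicator of an interval. Testing with the former gives uniqueness almost everywhere; testing
    with the latter gives the fundamental theorem of calculus between Lebesgue points, hence the
    continuous representative.

    Functions in [A] are not in H^1, so their representatives and derivatives are obtained by adding
    [vbar] and its derivative back. The gradient energy is always finite and is handled as a real
    number; the potential energy stays extended-valued, and the recovery argument treats its
    infinite case separately. *)

Section Derivatives.
Context {R : realType}.
Implicit Types (f g : R -> R) (x : R).

Lemma is_derive1E f x (d : R) : is_derive x 1 f d -> derive1 f x = d.
Proof. by move=> H; rewrite derive1E derive_val. Qed.

Lemma derivable_is_derive1 f x : derivable f x 1 -> is_derive x 1 f (derive1 f x).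
Proof. by move=> df; rewrite derive1E; apply: derivableP. Qed.

Lemma is_derive1_ext f g x (d e : R) :
  f =1 g -> d = e -> is_derive x 1 f d -> is_derive x 1 g e.
Proof. by move=> /funext -> ->. Qed.

Lemma is_derive1_lin f g x (a b df dg : R) :
  is_derive x 1 f df -> is_derive x 1 g dg ->
  is_derive x 1 (fun y => a * f y + b * g y) (a * df + b * dg).
Proof.
move=> Hf Hg; apply: (@is_derive1_ext ((a \*: f) + (b \*: g))) => //.
Qed.

Lemma is_derive1_mul f g x (df dg : R) :
  is_derive x 1 f df -> is_derive x 1 g dg ->
  is_derive x 1 (fun y => f y * g y) (df * g x + f x * dg).
Proof.
move=> Hf Hg; apply: (@is_derive1_ext (f * g)) (is_deriveM Hf Hg) => //.
by rewrite /GRing.scale/= addrC mulrC.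
Qed.

Lemma is_derive1_affine (c d x : R) : is_derive x 1 (fun y => c * y + d) c.
Proof.
apply: (@is_derive1_ext (fun y => c * id y + d * (cst 1 y)) _ _ (c * 1 + d * 0)).
- by move=> y /=; rewrite mulr1.
- by rewrite mulr1 mulr0 addr0.
Qed.

Lemma is_derive1_cst (c x : R) : is_derive x 1 (fun=> c) 0.
Proof. by have := is_derive1_affine 0 c x; apply: is_derive1_ext => // y; rewrite mul0r add0r. Qed.

Lemma is_derive1_near f g x (d : R) :
  (\forall y \near x, f y = g y) -> is_derive x 1 f d -> is_derive x 1 g d.
Proof. exact: near_eq_is_derive. Qed.

Lemma is_derive1_affine_comp f (c d x df : R) :
  is_derive (c * x + d) 1 f df -> is_derive x 1 (fun y => f (c * y + d)) (c * df).
Proof.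
move=> Hf; have Ha := is_derive1_affine c d x.
rewrite mulrC; exact: (@is_derive1_comp _ f (fun y => c * y + d)).
Qed.

Lemma derivable_continuous f : (forall x, derivable f x 1) -> continuous f.
Proof. by move=> df x; apply/differentiable_continuous/derivable1_diffP. Qed.

Definition smooth f := forall k x, derivable (nderiv k f) x 1.

(** Avoids any formula for the k-th derivative: it is enough to exhibit a class of differentiable
    functions closed under differentiation. *)
Lemma smooth_coind (S : (R -> R) -> Prop) :
  (forall f, S f -> (forall x, derivable f x 1) /\ S (derive1 f)) ->
  forall f, S f -> smooth f.
Proof.
move=> HS f Sf k; suff : S (nderiv k f) by move=> /HS[].
elim: k f Sf => [//|k IH] f /HS[_ Sf].
by rewrite /nderiv iterSr; apply: IH.
Qed.

Lemma smooth_derivable f : smooth f -> forall x, derivable f x 1.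
Proof. by move=> /(_ 0%N). Qed.

Lemma smooth_derive f : smooth f -> smooth (derive1 f).
Proof. by move=> sf k x; rewrite /nderiv -iterSr; apply: (sf k.+1). Qed.

Lemma smooth_antiderivative f : (forall x, derivable f x 1) -> smooth (derive1 f) -> smooth f.
Proof. by move=> df sf [|k] x; [exact: df|rewrite /nderiv iterSr; exact: sf]. Qed.

Lemma smooth_comp_affine f (c d : R) : smooth f -> smooth (fun x => f (c * x + d)).
Proof.
move=> sf.
(* The free factor [a] absorbs the power of [c] that each differentiation produces. *)
apply: (@smooth_coind (fun g => exists h a, smooth h /\ g = (fun x => a * h (c * x + d)))); last first.
  by exists f, 1; split => //; apply/funext => x; rewrite mul1r.
move=> _ [h [a [sh ->]]].
have H x : is_derive x 1 (fun x => a * h (c * x + d)) (a * c * derive1 h (c * x + d)).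
  have /is_derive1_affine_comp := derivable_is_derive1 (@smooth_derivable _ sh (c * x + d)).
  move=> /(fun H => is_derive1_lin a 0 H H).
  by apply: is_derive1_ext => [y|]; rewrite mul0r addr0// mulrA.
split; first by move=> x; exact: ex_derive.
exists (derive1 h), (a * c); split; first exact: smooth_derive.
by apply/funext => x; rewrite (is_derive1E (H x)).
Qed.

Lemma smooth_lin f g (a b : R) :
  smooth f -> smooth g -> smooth (fun x => a * f x + b * g x).
Proof.
move=> sf sg.
apply: (@smooth_coind (fun k => exists f g, [/\ smooth f, smooth g &
   k = (fun x => a * f x + b * g x)])); last by exists f, g.
move=> _ [h [k [sh sk ->]]].
have H x := is_derive1_lin a b (derivable_is_derive1 (@smooth_derivable _ sh x))
  (derivable_is_derive1 (@smooth_derivable _ sk x)).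
split; first by move=> x; have Hx := H x; exact: ex_derive.
exists (derive1 h), (derive1 k); split; try exact: smooth_derive.
by apply/funext => x; rewrite (is_derive1E (H x)).
Qed.

End Derivatives.

Section Bump.
Context {R : realType}.
Implicit Types x : R.

(** The function x^(-n) exp(-1/x), extended by 0. The index [n] is there to make the family closed
    under differentiation, up to linear combinations. *)
Definition flat (n : nat) x : R := if 0 < x then x^-1 ^+ n * expR (- x^-1) else 0.

(** Keep only the term of degree [n + 2] in the series of exp(1/x). The factor x^2 that remains is
    what makes [flat n] differentiable at 0, with derivative 0. *)
Lemma flat_bound n x : `|flat n x| <= (n.+2)`!%:R * x ^+ 2.
Proof.
rewrite /flat; case: ifPn => x0; last first.
  by rewrite normr0 mulr_ge0// sqr_ge0.
have xV : 0 < x^-1 by rewrite invr_gt0.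
rewrite ger0_norm; last by rewrite mulr_ge0 ?expR_ge0// exprn_ge0// ltW.
rewrite expRN.
have H : x^-1 ^+ n.+2 / n.+2`!%:R <= expR x^-1.
  by rewrite (le_trans _ (expR_ge1Dxn n.+1 (ltW xV)))// lerDr.
rewrite ler_pdivrMr ?expR_gt0//.
have F0 : 0 < n.+2`!%:R :> R by rewrite ltr0n fact_gt0.
apply: (@le_trans _ _ (n.+2`!%:R * x ^+ 2 * (x^-1 ^+ n.+2 / n.+2`!%:R))); last first.
  by rewrite ler_pM2l// mulr_gt0// exprn_gt0.
rewrite le_eqVlt; apply/orP; left; apply/eqP.
have xn := lt0r_neq0 x0; have Fn := lt0r_neq0 F0.
have -> : x^-1 ^+ n.+2 = x^-1 ^+ n * x ^- 2 by rewrite -addn2 exprD (exprVn x 2).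
set F := n.+2`!%:R : R; move: (x^-1 ^+ n) => E; rewrite [RHS](_ : _ = E * (x ^+ 2 * x ^- 2) * (F * F^-1)); last first.
  by move: (x ^+ 2)^-1 F^-1 (x ^+ 2) => a b c; ring.
by rewrite !divff ?mulr1// expf_neq0.
Qed.

Lemma flat_le0 n x : x <= 0 -> flat n x = 0.
Proof. by move=> x0; rewrite /flat ltNge x0. Qed.

Lemma is_derive_flat n x :
  is_derive x 1 (flat n) (- n%:R * flat n.+1 x + flat n.+2 x).
Proof.
have [x0|x0|->] := ltgtP x 0.
- rewrite !flat_le0 ?ltW// mulr0 addr0.
  apply: (@is_derive1_near _ (fun=> 0)).
  by near=> y; rewrite flat_le0//; apply/ltW; near: y; exact: lt_nbhsl.
- rewrite /flat x0.
  apply: (@is_derive1_near _ (fun y => y^-1 ^+ n * expR (- y^-1))).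
    near=> y; rewrite ifT//; near: y; exact: lt_nbhsr.
  have H1 : is_derive x 1 (fun y : R => y^-1) (- x ^- 2).
    have := @is_deriveV _ id x 1 1 (lt0r_neq0 x0) (is_derive_id _ _).
    by apply: is_derive1_ext => //; rewrite /GRing.scale/= mulr1.
  have H2 : is_derive x 1 (fun y : R => y^-1 ^+ n) (n%:R * x^-1 ^+ n.-1 * - x ^- 2).
    have := @is_deriveX _ _ _ n x 1 _ H1; apply: is_derive1_ext => // y.
    by elim: n => [|n IH]; rewrite ?expr0// !exprS -IH.
  have H3 : is_derive x 1 (fun y : R => expR (- y^-1)) (expR (- x^-1) * x ^- 2).
    apply: (@is_derive1_comp _ expR (fun y => - y^-1)).
    by have := is_deriveN H1; apply: is_derive1_ext => //; rewrite opprK.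
  have := is_derive1_mul H2 H3; apply: is_derive1_ext => //.
  case: n {H2} => [|n]; rewrite ?expr0 /= ?exprSr; field; exact: lt0r_neq0.
- rewrite !flat_le0// mulr0 addr0.
  have Hn : (fun h : R => n.+2`!%:R * `|h|) @ (0:R)^' --> (0:R).
    have F0 : 0 < n.+2`!%:R :> R by rewrite ltr0n fact_gt0.
    apply/cvgrPdist_le => e e0; near=> h.
    rewrite sub0r normrN normrM normr_id (ger0_norm (ltW F0)) mulrC -(@ler_pdivlMr R)//.
    near: h; apply: dnbhs0_le; exact: divr_gt0.
  (* By [flat_bound] the difference quotient at 0 is at most (n+2)! |h|. *)
  have H : (fun h : R => h^-1 *: ((flat n \o shift 0) (h *: 1) - flat n 0)) @ 0^' --> (0:R).
    apply: (@squeeze_cvgr _ _ _ _ (fun h => - (n.+2`!%:R * `|h|)) (fun h => n.+2`!%:R * `|h|)).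
    + near=> h; rewrite -ler_norml (flat_le0 _ (lexx 0)) subr0 /= addr0 /GRing.scale/= mulr1 normrM.
      have h0 : h != 0 by near: h; exact: nbhs_dnbhs_neq.
      rewrite normfV ler_pdivrMl ?normr_gt0//.
      by rewrite (le_trans (flat_bound _ _))// -(real_normK (num_real h)) expr2 mulrCA.
    + by rewrite -[X in _ --> X]oppr0; apply: cvgN.
    + exact: Hn.
  apply: DeriveDef; first by apply/cvg_ex; exists 0.
  exact: cvg_lim H.
Unshelve. all: by end_near. Qed.

(** The class fed to [smooth_coind]: the product rule maps each generator to a combination of four
    generators. *)
Inductive bump_span : (R -> R) -> Prop :=
| bump_span_base n m : bump_span (fun x => flat n x * flat m (-1 * x + 1))
| bump_span_lin (a b : R) f g : bump_span f -> bump_span g ->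
    bump_span (fun x => a * f x + b * g x).

Lemma bump_span_derive f : bump_span f ->
  exists2 g, bump_span g & forall x, is_derive x 1 f (g x).
Proof.
elim=> [n m|a b f1 g1 _ [f1' Sf1 Df1] _ [g1' Sg1 Dg1]]; last first.
  exists (fun x => a * f1' x + b * g1' x); first exact: bump_span_lin.
  by move=> x; exact: is_derive1_lin.
pose B i j x := flat i x * flat j (-1 * x + 1).
exists (fun x => 1 * (- n%:R * B n.+1 m x + 1 * B n.+2 m x) +
  (-1) * (- m%:R * B n m.+1 x + 1 * B n m.+2 x)).
  apply: (bump_span_lin 1 (-1)
    (f := fun x => - n%:R * B n.+1 m x + 1 * B n.+2 m x)
    (g := fun x => - m%:R * B n m.+1 x + 1 * B n m.+2 x));
    apply: bump_span_lin; exact: bump_span_base.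
move=> x; have := is_derive1_mul (is_derive_flat n x)
  (is_derive1_affine_comp (is_derive_flat m (-1 * x + 1))).
by apply: is_derive1_ext => //; rewrite /B; ring.
Qed.

Definition flat_bump x : R := flat 0 x * flat 0 (-1 * x + 1).

Lemma smooth_bump : smooth flat_bump.
Proof.
apply: (@smooth_coind _ bump_span); last exact: bump_span_base.
move=> f /bump_span_derive[g Sg Dg]; split; first by move=> x; exact: ex_derive.
by rewrite (_ : derive1 f = g)//; apply/funext => x; exact: is_derive1E.
Qed.

Lemma flat0_itv01 x : 0 <= flat 0 x <= 1.
Proof.
rewrite /flat; case: ifPn => x0; rewrite ?lexx ?ler01//.
by rewrite expr0 mul1r expR_ge0 expR_le1 oppr_le0 invr_ge0 ltW.
Qed.

Lemma bump_itv01 x : 0 <= flat_bump x <= 1.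
Proof.
have /andP[a0 a1] := flat0_itv01 x; have /andP[b0 b1] := flat0_itv01 (-1 * x + 1).
by rewrite mulr_ge0// mulr_ile1.
Qed.

Lemma bump_le0 x : x <= 0 -> flat_bump x = 0.
Proof. by move=> x0; rewrite /flat_bump flat_le0// mul0r. Qed.

Lemma bump_ge1 x : 1 <= x -> flat_bump x = 0.
Proof. by move=> x1; rewrite /flat_bump [X in _ * X]flat_le0 ?mulr0//; lra. Qed.

Lemma bump_gt0 x : 0 < x < 1 -> 0 < flat_bump x.
Proof.
move=> /andP[x0 x1]; have y0 : 0 < -1 * x + 1 by lra.
by rewrite /flat_bump /flat x0 y0 !expr0 !mul1r mulr_gt0 ?expR_gt0.
Qed.

(** Starting the integral at -1 keeps it on a compact interval. Since the bump vanishes on the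
    negative half-line, the integral is locally 0 around any point [x <= -1], which settles the
    points where the fundamental theorem does not apply. *)
Lemma bump_antiderivative : exists F : R -> R, forall x, is_derive x 1 F (flat_bump x).
Proof.
have cb : continuous flat_bump by apply: derivable_continuous; exact: smooth_derivable smooth_bump.
exists (fun y => \int[lebesgue_measure]_(t in `[-1, y]) flat_bump t) => x.
have [x1|x1] := ltP (-1) x.
  have xx1 : x < x + 1 by lra.
  have ib : lebesgue_measure.-integrable `[-1, x + 1] (EFin \o flat_bump).
    apply: continuous_compact_integrable; first exact: segment_compact.
    by apply: continuous_subspaceT.
  have [dF F'] := @continuous_FTC1_closed R flat_bump (-1) x (x + 1) xx1 ib x1 (cb x).
  by rewrite -F'; exact: derivable_is_derive1.
rewrite bump_le0; last by lra.
apply: (@is_derive1_near _ (fun=> 0)).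
near=> y; have y0 : y <= 0 by apply/ltW; near: y; apply: lt_nbhsl; lra.
rewrite (@eq_Rintegral _ _ _ _ _ (fun=> 0)).
  by rewrite Rintegral_cst// mul0r.
move=> t; rewrite inE/= in_itv/= => /andP[_ ty].
by rewrite bump_le0//; lra.
Unshelve. all: by end_near. Qed.

(** The step is the primitive of the bump, normalised to rise from 0 to 1. It is constant on both
    sides because the bump vanishes outside [0, 1]. *)
Lemma smooth_step : exists psi : R -> R, [/\ smooth psi,
  forall x, x <= 0 -> psi x = 0, forall x, 1 <= x -> psi x = 1,
  forall x, 0 <= psi x <= 1 & exists C, forall x, `|derive1 psi x| <= C].
Proof.
have [F DF] := bump_antiderivative.
have mvt a b : a <= b -> exists2 c, c \in `[a, b]%R & F b - F a = flat_bump c * (b - a).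
  move=> ab; apply: MVT_segment => //.
  by apply/continuous_subspaceT/derivable_continuous => x; exact: ex_derive.
have Z0 : 0 < F 1 - F 0.
  have F_nd a b : a <= b -> F a <= F b.
    move=> ab; have [c _ H] := mvt _ _ ab.
    rewrite -subr_ge0 H mulr_ge0//; last by rewrite subr_ge0.
    by have /andP[] := bump_itv01 c.
  (* On [0, 1] the mean value point could be an endpoint, where the bump is 0; on [1/4, 1/2] it
     cannot. *)
  have h : (4^-1 : R) <= 2^-1 by lra.
  have [c /[!in_itv]/= /andP[c1 c2] H] := mvt _ _ h.
  have : 0 < F 2^-1 - F 4^-1.
    by rewrite H mulr_gt0//; [apply: bump_gt0; apply/andP; split; lra|lra].
  have := @F_nd 0 4^-1; have := @F_nd 2^-1 1.
  by move=> /(_ ltac:(lra)) + /(_ ltac:(lra)); lra.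
set Z := F 1 - F 0 in Z0.
pose psi x := Z^-1 * F x + (- F 0 / Z) * 1.
have Dpsi x : is_derive x 1 psi (Z^-1 * flat_bump x).
  have := is_derive1_lin Z^-1 (- F 0 / Z) (DF x) (is_derive1_cst 1 x).
  by apply: is_derive1_ext => //; rewrite mulr0 addr0.
have psiE x : psi x = (F x - F 0) / Z by rewrite /psi; ring.
have psi'E : derive1 psi = (fun x => Z^-1 * flat_bump x + 0 * flat_bump x).
  by apply/funext => x; rewrite (is_derive1E (Dpsi x)) mul0r addr0.
have p0 x : x <= 0 -> psi x = 0.
  move=> x0; have [c /[!in_itv]/= /andP[c1 c2] H] := mvt _ _ x0.
  by rewrite psiE -opprB H bump_le0 ?mul0r ?oppr0 ?mul0r//; lra.
have p1 x : 1 <= x -> psi x = 1.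
  move=> x1; have [c /[!in_itv]/= /andP[c1 c2] H] := mvt _ _ x1.
  rewrite psiE (_ : F x - F 0 = Z) ?divff ?lt0r_neq0//.
  by move: H; rewrite bump_ge1// mul0r /Z; lra.
have pnd a b : a <= b -> psi a <= psi b.
  move=> ab; have [c _ H] := mvt _ _ ab.
  rewrite !psiE ler_pM2r ?invr_gt0// lerD2r -subr_ge0 H mulr_ge0//; last by rewrite subr_ge0.
  by have /andP[] := bump_itv01 c.
exists psi; split => //.
- apply: smooth_antiderivative; first by move=> x; exact: ex_derive.
  by rewrite psi'E; apply: smooth_lin; exact: smooth_bump.
- move=> x; have [x0|x0] := lerP x 0; first by rewrite p0// lexx ler01.
  have [x1|x1] := lerP 1 x; first by rewrite p1// lexx ler01.
  by have := pnd 0 x (ltW x0); have := pnd x 1 (ltW x1); rewrite (p0 0)// (p1 1)// => -> ->.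
- have ZV : 0 <= Z^-1 by rewrite invr_ge0 ltW.
  exists Z^-1 => x; have /andP[b0 b1] := bump_itv01 x.
  have H0 : 0 <= Z^-1 * flat_bump x by apply: mulr_ge0.
  by rewrite psi'E mul0r addr0 ger0_norm// ler_piMr.
Qed.

End Bump.

(** * Integrals over the line *)


Section IntegralToolkit.
Context {R : realType}.
Local Notation mu := (@lebesgue_measure R).
Local Notation I f := (Rintegral mu setT f).
Implicit Types (f g h : R -> R) (a b x : R).

Lemma ae1 (P Q : R -> Prop) : (forall x, P x -> Q x) ->
  {ae mu, forall x, P x} -> {ae mu, forall x, Q x}.
Proof. exact: (@filterS _ _ (ae_filter_ringOfSetsType mu)). Qed.

Lemma ae2 (P Q S : R -> Prop) : (forall x, P x -> Q x -> S x) ->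
  {ae mu, forall x, P x} -> {ae mu, forall x, Q x} -> {ae mu, forall x, S x}.
Proof.
move=> PQS aP aQ; apply: ae1 (@filterI _ _ (ae_filter_ringOfSetsType mu) _ _ aP aQ).
by move=> x [? ?]; exact: PQS.
Qed.

Definition intg f := mu.-integrable setT (fun x => (f x)%:E).

Lemma intg_measurable f : intg f -> measurable_fun setT f.
Proof. by move=> /integrableP[/measurable_EFinP]. Qed.

Lemma EFin_I f : intg f -> (\int[mu]_x (f x)%:E = (I f)%:E)%E.
Proof. by move=> If; rewrite /Rintegral fineK// integrable_fin_num. Qed.

Lemma intg_dom f g : measurable_fun setT f -> intg g ->
  (forall x, `|f x| <= g x) -> intg f.
Proof.
move=> mf Ig fg; apply: le_integrable Ig => //; first exact/measurable_EFinP.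
by move=> x _ /=; rewrite lee_fin (le_trans (fg x))// ler_norm.
Qed.

Lemma intg_norm f : intg f -> intg (fun x => `|f x|).
Proof. exact: integrable_norm. Qed.

Lemma intg_ext f g : f =1 g -> intg f -> intg g.
Proof. by move=> /funext ->. Qed.

Lemma intgZ a f : intg f -> intg (fun x => a * f x).
Proof. by move=> If; have := integrableZl measurableT a If. Qed.

Lemma intgD f g : intg f -> intg g -> intg (fun x => f x + g x).
Proof. by move=> If Ig; have := integrableD measurableT If Ig. Qed.

Lemma intg_lin a b f g : intg f -> intg g -> intg (fun x => a * f x + b * g x).
Proof. by move=> If Ig; apply: intgD; exact: intgZ. Qed.

Lemma I_lin a b f g : intg f -> intg g ->
  I (fun x => a * f x + b * g x) = a * I f + b * I g.
Proof. by move=> If Ig; rewrite RintegralD ?RintegralZl//; exact: intgZ. Qed.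

Lemma I0 : I (fun=> 0) = 0.
Proof. by rewrite Rintegral_cst// mul0r. Qed.

Lemma IZ a f : intg f -> I (fun x => a * f x) = a * I f.
Proof. by move=> If; rewrite RintegralZl. Qed.

Lemma IB f g : intg f -> intg g -> I (fun x => f x - g x) = I f - I g.
Proof. by move=> If Ig; rewrite RintegralB. Qed.

Lemma intgB f g : intg f -> intg g -> intg (fun x => f x - g x).
Proof.
by move=> If Ig; apply: (intg_ext _ (intg_lin 1 (-1) If Ig)) => x; rewrite mul1r mulN1r.
Qed.

Lemma I_le f g : intg f -> intg g -> (forall x, f x <= g x) -> I f <= I g.
Proof. by move=> If Ig fg; apply: le_Rintegral. Qed.

Lemma I_ge0 f : (forall x, 0 <= f x) -> 0 <= I f.
Proof. by move=> f0; apply: Rintegral_ge0. Qed.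

Lemma I_abs f : intg f -> `|I f| <= I (fun x => `|f x|).
Proof. exact: le_normr_Rintegral. Qed.

Lemma I_abs_le f g : intg f -> intg g -> (forall x, `|f x| <= g x) -> `|I f| <= I g.
Proof.
by move=> If Ig fg; rewrite (le_trans (I_abs If))//; apply: I_le => //; exact: intg_norm.
Qed.

Lemma I_ae f g : measurable_fun setT f -> measurable_fun setT g ->
  {ae mu, forall x, f x = g x} -> I f = I g.
Proof.
move=> mf mg fg; congr fine; apply: ae_eq_integral => //; try exact/measurable_EFinP.
by apply: ae1 fg => x fgx _; rewrite fgx.
Qed.

Lemma intg_ae f g : measurable_fun setT g ->
  {ae mu, forall x, f x = g x} -> intg f -> intg g.
Proof.
move=> mg fg /integrableP[mf fi]; apply/integrableP; split; first exact/measurable_EFinP.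
rewrite (_ : integral _ _ _ = \int[mu]_x `|(f x)%:E|)%E//.
apply: ae_eq_integral => //; try by apply: measurableT_comp => //; exact/measurable_EFinP.
by apply: ae1 fg => x fgx _; rewrite fgx.
Qed.

(** Half-open, so that indicators of adjacent intervals add up exactly and the cells of a grid
    partition the line. *)
Definition chi a b : R -> R := \1_`[a, b[.

Lemma chiE a b x : chi a b x = (a <= x < b)%R%:R.
Proof. by rewrite /chi indicE mem_setE in_itv. Qed.

Lemma chi_itv01 a b x : 0 <= chi a b x <= 1.
Proof. by rewrite chiE; case: (_ <= _ < _); rewrite ?lexx ?ler01. Qed.

Lemma chi_norm a b x : `|chi a b x| <= 1.
Proof. by have /andP[h0 h1] := chi_itv01 a b x; rewrite ger0_norm. Qed.

Lemma chi_sqr a b x : chi a b x ^+ 2 = chi a b x.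
Proof. by rewrite chiE; case: (_ <= _ < _); rewrite ?expr1n// expr0n. Qed.

Lemma chi_split a b c x : a <= b -> b <= c -> chi a c x = chi a b x + chi b c x.
Proof.
move=> ab bc; rewrite !chiE; have [bx|xb] := leP b x.
  by rewrite (le_trans ab bx) add0r.
by rewrite (lt_le_trans xb bc) addr0.
Qed.

Lemma measurable_chi a b : measurable_fun setT (chi a b).
Proof. exact: measurable_indic. Qed.

Lemma intg_chi a b : intg (chi a b).
Proof. exact: integrable_indic_itv. Qed.

Lemma I_chi a b : a <= b -> I (chi a b) = b - a.
Proof.
move=> ab; rewrite /chi /Rintegral integral_indic// setIT.
have H : mu `[a, b[ = (b - a)%:E.
  have := @lebesgue_measure_itv R `[a, b[; rewrite /= lte_fin => ->.
  by move: ab; rewrite le_eqVlt => /predU1P[->|->//]; rewrite ltxx subrr.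
by transitivity (fine (b - a)%:E); first exact: (congr1 fine H).
Qed.

Lemma mul_chi_patch f a b : (fun x => f x * chi a b x) = f \_ `[a, b[.
Proof.
apply/funext => x; rewrite chiE patchE mem_setE in_itv/=.
by case: ifPn => _; rewrite ?mulr1 ?mulr0.
Qed.

Lemma intg_chi_patch f a b :
  intg (fun x => f x * chi a b x) <-> mu.-integrable `[a, b[ (EFin \o f).
Proof.
rewrite /intg (_ : (fun x => _) = (EFin \o f) \_ `[a, b[).
  by symmetry; exact: integrable_mkcond.
by rewrite restrict_EFin -mul_chi_patch.
Qed.

Lemma intg_mul_chi f a b : loc_integrable f -> intg (fun x => f x * chi a b x).
Proof.
move=> [_ lf]; apply/intg_chi_patch; apply: integrableS (lf a b) => //.
by move=> x; rewrite /= !in_itv/= => /andP[-> /ltW->].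
Qed.

Lemma loc_integrable_chi f : measurable_fun setT f ->
  (forall a b, intg (fun x => f x * chi a b x)) -> loc_integrable f.
Proof.
move=> mf If; split => // a b.
(* The right end is moved to [b + 1] because [chi] leaves out its own right endpoint. *)
have /intg_chi_patch := If a (b + 1).
by apply: integrableS => //; move=> x; rewrite /= !in_itv/= => /andP[-> xb]/=; lra.
Qed.

Lemma intg_mul_bounded f g (C : R) : measurable_fun setT g -> (forall x, `|g x| <= C) ->
  intg f -> intg (fun x => f x * g x).
Proof.
move=> mg gC If; have mf := intg_measurable If.
apply: (intg_dom _ (intgZ C (intg_norm If))); first exact: measurable_funM.
by move=> x; rewrite normrM mulrC ler_wpM2r.
Qed.

Lemma loc_integrable_continuous f : continuous f -> loc_integrable f.
Proof.
move=> cf; split; first exact: continuous_measurable_fun.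
move=> a b; apply: continuous_compact_integrable; first exact: segment_compact.
exact: continuous_subspaceT.
Qed.

Lemma loc_integrable_lin a b f g : loc_integrable f -> loc_integrable g ->
  loc_integrable (fun x => a * f x + b * g x).
Proof.
move=> lf lg; apply: loc_integrable_chi.
  by apply: measurable_funD; apply: measurable_funM => //; [exact: lf.1|exact: lg.1].
move=> c d; have := intg_lin a b (intg_mul_chi c d lf) (intg_mul_chi c d lg).
by apply: intg_ext => x; rewrite mulrDl !mulrA.
Qed.

Lemma locally_integrable_loc f : loc_integrable f -> locally_integrable setT f.
Proof.
move=> [mf lf]; split => //; first exact: openT.
move=> K _ cK.
have [M [Mr HM]] := compact_bounded cK.
have KM : K `<=` `[- (M + 1), M + 1].
  move=> x Kx; rewrite /= in_itv/= -ler_norml; apply: HM => //; lra.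
have /integrableP[mf' H] := lf (- (M + 1)) (M + 1).
apply: le_lt_trans H; apply: ge0_subset_integral => //=.
- exact: compact_measurable.
- by do 2 apply: measurableT_comp => //; exact: measurable_funTS.
Qed.

Lemma FTC_chi F f a b : a <= b -> continuous f -> (forall x, is_derive x 1 F (f x)) ->
  I (fun x => f x * chi a b x) = F b - F a.
Proof.
move=> + cf DF; rewrite le_eqVlt => /predU1P[->|ab].
  rewrite subrr -[RHS]I0; congr (I _); apply/funext => x.
  by rewrite chiE leNgt; case: ltP; rewrite ?mulr0.
have cF : continuous F by apply: derivable_continuous => x; exact: ex_derive.
rewrite mul_chi_patch -Rintegral_mkcond Rintegral_itv_bndo_bndc.
  rewrite /Rintegral (@continuous_FTC2 _ f F)//.
  - exact: continuous_subspaceT.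
  - split.
    + by move=> x _; exact: ex_derive.
    + by apply: cvg_at_right_filter; exact: cF.
    + by apply: cvg_at_left_filter; exact: cF.
  - by move=> x _; exact: is_derive1E.
by apply/intg_chi_patch/intg_mul_chi/loc_integrable_continuous.
Qed.

End IntegralToolkit.

Section SquareIntegrable.
Context {R : realType}.
Local Notation mu := (@lebesgue_measure R).
Local Notation I f := (Rintegral mu setT f).
Local Notation L2 := (L2_on setT).
Implicit Types (f g h : R -> R) (a b x : R).

Lemma L2_mul f g : L2 f -> L2 g -> intg (fun x => f x * g x).
Proof.
move=> [mf If] [mg Ig]; apply: (intg_dom _ (intgD If Ig)).
  exact: measurable_funM.
move=> x; rewrite ler_norml; apply/andP; split.
  by have := sqr_ge0 (f x + g x); have := sqr_ge0 (f x); have := sqr_ge0 (g x); nra.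
by have := sqr_ge0 (f x - g x); have := sqr_ge0 (f x); have := sqr_ge0 (g x); nra.
Qed.

Lemma L2_lin a b f g : L2 f -> L2 g -> L2 (fun x => a * f x + b * g x).
Proof.
move=> Hf Hg; have [mf If] := Hf; have [mg Ig] := Hg.
split; first by apply: measurable_funD; apply: measurable_funM.
have := intgD (intg_lin (a ^+ 2) (b ^+ 2) If Ig) (intgZ (2 * a * b) (L2_mul Hf Hg)).
by apply: intg_ext => x; ring.
Qed.

Lemma L2_ext f g : f =1 g -> L2 f -> L2 g.
Proof. by move=> /funext ->. Qed.

Lemma L2B f g : L2 f -> L2 g -> L2 (fun x => f x - g x).
Proof.
by move=> Hf Hg; apply: L2_ext (L2_lin 1 (-1) Hf Hg) => x; rewrite mul1r mulN1r.
Qed.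

Lemma L2_chi a b : L2 (chi a b).
Proof.
split; first exact: measurable_chi.
by apply: (intg_ext _ (intg_chi a b)) => x; rewrite chi_sqr.
Qed.

Lemma L2_loc f : L2 f -> loc_integrable f.
Proof.
by move=> Hf; apply: loc_integrable_chi; [exact: Hf.1|move=> a b; exact/L2_mul/L2_chi].
Qed.

Lemma L2_mul_chi f a b : L2 f -> L2 (fun x => f x * chi a b x).
Proof.
move=> [mf If]; split; first by apply: measurable_funM => //; exact: measurable_chi.
apply: (intg_dom _ If); first by apply: measurable_funX; apply: measurable_funM => //; exact: measurable_chi.
move=> x; rewrite ger0_norm ?sqr_ge0// exprMn chi_sqr ler_piMr ?sqr_ge0//.
by have /andP[] := chi_itv01 a b x.
Qed.

(** The quadratic A + 2tB + t^2 C is the integral of (f + t g)^2, hence nonnegative. Its value at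
    the minimiser t = -B/C gives the claim; if C = 0 it is affine in t, and a nonzero B would allow
    the value -1. *)
Lemma cauchy_schwarz f g : L2 f -> L2 g ->
  I (fun x => f x * g x) ^+ 2 <= I (fun x => f x ^+ 2) * I (fun x => g x ^+ 2).
Proof.
move=> Hf Hg; have Ifg := L2_mul Hf Hg; have [_ If] := Hf; have [_ Ig] := Hg.
set A := I (fun x => f x ^+ 2); set B := I (fun x => f x * g x); set C := I (fun x => g x ^+ 2).
have C0 : 0 <= C by apply: I_ge0 => x; exact: sqr_ge0.
have H t : 0 <= A + 2 * t * B + t ^+ 2 * C.
  have -> : A + 2 * t * B + t ^+ 2 * C = I (fun x => (f x + t * g x) ^+ 2).
    rewrite -[A]mul1r -(I_lin 1 (2 * t) If Ifg) -[X in X + _]mul1r.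
    rewrite -(I_lin 1 (t ^+ 2) (intg_lin 1 (2 * t) If Ifg) Ig).
    by apply: eq_Rintegral => x _; ring.
  by apply: I_ge0 => x; exact: sqr_ge0.
have [Cpos|CN] := ltP 0 C; last first.
  have C00 : C = 0 by apply/eqP; rewrite eq_le CN C0.
  rewrite C00 mulr0 leNgt; apply/negP => B2.
  have BN : B != 0 by apply: contraTneq B2 => ->; rewrite expr0n ltxx.
  have := H (- (A + 1) / (2 * B)); rewrite C00 mulr0 addr0.
  rewrite (_ : 2 * _ * B = - (A + 1)); last by field.
  by rewrite opprD addNKr oppr_ge0 ler10.
have := H (- B / C); rewrite (_ : _ + _ = A - B ^+ 2 / C); last by field; exact: lt0r_neq0.
by rewrite subr_ge0 ler_pdivrMr.
Qed.

Lemma I_chi_sqr f a b : a <= b -> L2 f ->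
  I (fun x => f x * chi a b x) ^+ 2 <= (b - a) * I (fun x => f x ^+ 2 * chi a b x).
Proof.
move=> ab Hf; have := cauchy_schwarz (L2_chi a b) (L2_mul_chi a b Hf).
have -> : (fun x => chi a b x * (f x * chi a b x)) = (fun x => f x * chi a b x).
  by apply/funext => x; rewrite -[in RHS]chi_sqr; ring.
have -> : (fun x => chi a b x ^+ 2) = chi a b by apply/funext => x; rewrite chi_sqr.
have -> : (fun x => (f x * chi a b x) ^+ 2) = (fun x => f x ^+ 2 * chi a b x).
  by apply/funext => x; rewrite exprMn chi_sqr.
by rewrite I_chi.
Qed.

End SquareIntegrable.

(** * Lebesgue points and test functions *)


Section LebesguePoints.
Context {R : realType}.
Local Notation mu := (@lebesgue_measure R).
Local Notation I f := (Rintegral mu setT f).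
Implicit Types (f g h k : R -> R) (a b x y : R).

Lemma loc_integrable_dist h x : loc_integrable h -> loc_integrable (fun y => `|h y - h x|).
Proof.
move=> lh; have lc : loc_integrable (fun=> h x).
  by apply: loc_integrable_continuous => z; exact: cvg_cst.
have [m l] := loc_integrable_lin 1 (-1) lh lc.
rewrite (_ : (fun y => _) = ((@Num.norm _ R) \o (fun y => 1 * h y + -1 * h x))); last first.
  by apply/funext => y /=; rewrite mul1r mulN1r.
split; first exact: measurableT_comp.
by move=> a b; apply: integrable_norm; exact: l.
Qed.

(** Unfolds the average over a ball into an integral against [chi]. The tolerance is halved in the
    proof because the ball of radius [r] has length 2r. *)
Lemma lebesgue_pt_small h x (e : R) : loc_integrable h -> lebesgue_pt h x -> 0 < e ->
  exists2 d, 0 < d &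
    forall r, 0 < r < d -> I (fun y => `|h y - h x| * chi (x - r) (x + r) y) <= e * r.
Proof.
move=> lh /fine_cvgP[fin Hx] e0.
have e2 : 0 < e / 2 by rewrite divr_gt0.
have [d1 /= d10 H1] := fin.
have [d2 /= d20 H2] := (@cvgr0_norm_lt _ _ _ _ _ _ Hx _ e2).
exists (Num.min d1 d2); first by rewrite lt_min d10 d20.
move=> r /andP[r0]; rewrite lt_min => /andP[rd1 rd2].
have Br (d : R) : r < d -> ball_ (@Num.norm _ R) 0 d r.
  by rewrite /ball_/= sub0r normrN gtr0_norm.
have := H2 r (Br _ rd2) r0; rewrite /= => {}H2.
have {H1} : davg h x r \is a fin_num := H1 r (Br _ rd1) r0.
set J := I _.
have dE : davg h x r = ((r *+ 2)^-1 * J)%:E.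
  rewrite /davg /iavg lebesgue_measure_ball ?ltW// inver mulrn_eq0/= gt_eqF// EFinM.
  congr (_ * _)%E; rewrite /J -EFin_I; last exact/intg_mul_chi/loc_integrable_dist.
  have md : measurable_fun setT (fun y => `|h y - h x|) := (loc_integrable_dist x lh).1.
  rewrite ball_itv.
  rewrite (_ : \int[mu]_(y in _) _ = \int[mu]_(y in `](x - r)%R, (x + r)%R[) (`|h y - h x|)%:E)%E//.
  rewrite -(@integral_itv_bndoo _ _ _ _ true true); last first.
    by apply/measurable_EFinP; exact: measurable_funTS.
  rewrite [RHS]integral_mkcond; apply: eq_integral => y _.
  by rewrite patchE mem_setE in_itv/= chiE; case: (_ <= _ < _); rewrite ?mulr1 ?mulr0.
have r2 : 0 < r *+ 2 by rewrite mulrn_wgt0.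
move=> _; move: H2; rewrite dE /= => /ltW /(le_trans (ler_norm _)).
by rewrite ler_pdivrMl// (_ : r *+ 2 * (e / 2) = e * r)//; field.
Qed.

(** As [k] has integral one, [h x] can be moved under the integral, leaving (h y - h x) k y. Only
    the size and support of [k] enter, so the estimate covers both smooth kernels and the normalised
    indicators behind difference quotients. *)
Lemma kernel_bound h k x (C r : R) : 0 <= C -> 0 < r -> loc_integrable h ->
  measurable_fun setT k -> (forall y, `|k y| <= C / r * chi (x - r) (x + r) y) -> I k = 1 ->
  intg (fun y => h y * k y) /\
  `|I (fun y => h y * k y) - h x| <=
    C / r * I (fun y => `|h y - h x| * chi (x - r) (x + r) y).
Proof.
move=> C00 r0 lh mk kC Ik1.
have Ik : intg k by apply: (intg_dom mk (intgZ (C / r) (intg_chi (x - r) (x + r)))).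
have C0 : 0 <= C / r by rewrite divr_ge0// ltW.
have Id : intg (fun y => `|h y - h x| * chi (x - r) (x + r) y).
  exact/intg_mul_chi/loc_integrable_dist.
have md : measurable_fun setT (fun y => h y - h x) by apply: measurable_funB => //; exact: lh.1.
have Idk : intg (fun y => (h y - h x) * k y).
  apply: (intg_dom _ (intgZ (C / r) Id)); first exact: measurable_funM.
  by move=> y; rewrite normrM mulrCA ler_wpM2l.
have Ihk : intg (fun y => h y * k y).
  by apply: (intg_ext _ (intg_lin 1 (h x) Idk Ik)) => y; ring.
split=> //.
have -> : I (fun y => h y * k y) - h x = I (fun y => (h y - h x) * k y).
  rewrite -[X in _ - X]mulr1 -[in X in _ - X]Ik1 -IZ// -IB//; last exact: intgZ.
  by apply: eq_Rintegral => y _; ring.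
rewrite -IZ//; apply: I_abs_le => //; first exact: intgZ.
by move=> y; rewrite normrM mulrCA ler_wpM2l.
Qed.

Lemma kernel_cvg h x (k : nat -> R -> R) (r : nat -> R) (C : R) :
  0 <= C -> loc_integrable h -> lebesgue_pt h x -> (forall n, 0 < r n) -> r @ \oo --> (0:R) ->
  (forall n, measurable_fun setT (k n)) ->
  (forall n y, `|k n y| <= C / r n * chi (x - r n) (x + r n) y) ->
  (forall n, I (k n) = 1) ->
  (fun n => I (fun y => h y * k n y)) @ \oo --> h x.
Proof.
move=> C0 lh hx r0 rcvg mk kC Ik.
apply/cvgrPdist_le => e e0.
(* [C] may be 0, so the tolerance is divided by [C + 1]. *)
have C1 : 0 < C + 1 by lra.
have [d d0 Hd] := lebesgue_pt_small lh hx (divr_gt0 e0 C1).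
near=> n.
have rd : r n < d.
  by rewrite -(ger0_norm (ltW (r0 n))); near: n; exact: (@cvgr0_norm_lt _ _ _ _ _ _ rcvg _ d0).
have [_ H] := kernel_bound C0 (r0 n) lh (mk n) (kC n) (Ik n).
rewrite distrC (le_trans H)//.
have rn := lt0r_neq0 (r0 n).
apply: (@le_trans _ _ (C / r n * (e / (C + 1) * r n))).
  by rewrite ler_wpM2l ?Hd ?r0// divr_ge0// ltW.
rewrite (_ : C / r n * (e / (C + 1) * r n) = e * (C / (C + 1))); last first.
  by field; rewrite rn lt0r_neq0.
by rewrite ler_piMr ?(ltW e0)// ler_pdivrMr//; lra.
Unshelve. all: by end_near. Qed.

Lemma ae_lebesgue_pt h : loc_integrable h -> {ae mu, forall x, lebesgue_pt h x}.
Proof. by move=> /locally_integrable_loc; exact: lebesgue_differentiation. Qed.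

(** Otherwise an interval of positive length would lie in a null set. *)
Lemma ae_dense (P : R -> Prop) a b : a < b -> {ae mu, forall x, P x} ->
  exists2 x, a < x < b & P x.
Proof.
move=> ab [N [mN N0 PN]]; apply: contrapT => H.
have : `]a, b[ `<=` N.
  move=> x; rewrite /= in_itv/= => xab; apply: PN => /= Px.
  by apply: H; exists x.
move=> abN; have M : mu `]a, b[ = (b - a)%:E.
  by have := @lebesgue_measure_itv R `]a, b[; rewrite /= lte_fin ab.
have : (mu `]a, b[ <= mu N)%E by apply: le_measure => //; rewrite inE.
rewrite M (N0 : mu N = 0%E) lee_fin; lra.
Qed.

Lemma continuous_ae_eq f g : continuous f -> continuous g ->
  {ae mu, forall x, f x = g x} -> f = g.
Proof.
move=> cf cg fg; apply/funext => x; apply/eqP; rewrite -subr_eq0 -normr_le0.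
apply/ler_addgt0Pl => e e0; rewrite addr0.
have Hc : (fun y => f y - g y) @ x --> f x - g x by apply: cvgB; [exact: cf|exact: cg].
have := cvgr_dist_le _ _ Hc _ e0.
move=> [d /= d0 Hd].
have [y /andP[xy yx] fgy] := @ae_dense _ x (x + d) ltac:(lra) fg.
have := Hd y; rewrite /= fgy subrr subr0; apply.
by rewrite /ball/= distrC ltr_norml; apply/andP; split; lra.
Qed.

End LebesguePoints.

Section WeakDerivative.
Context {R : realType}.
Local Notation mu := (@lebesgue_measure R).
Local Notation I f := (Rintegral mu setT f).
Local Notation L2 := (L2_on setT).
Implicit Types (f g h k phi : R -> R) (a b x y : R).

Lemma test_continuous phi : test_fun phi -> continuous phi.
Proof. by move=> [sphi _]; apply: derivable_continuous; exact: smooth_derivable. Qed.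

Lemma test_derive phi : test_fun phi -> test_fun (derive1 phi).
Proof.
move=> [sphi [M HM]]; split; first exact: smooth_derive.
exists M => x Mx; apply: is_derive1E; apply: (@is_derive1_near _ (fun=> 0)).
have : \forall y \near x, M < `|y|.
  have := @norm_continuous R R^o x => /(_ _ (lt_nbhsr Mx)).
  by [].
by apply: filterS => y /HM.
Qed.

(** Domination by a multiple of an indicator makes the product of a test function with any locally
    integrable function integrable. *)
Lemma test_bound phi : test_fun phi ->
  exists C a b, a <= b /\ forall x, `|phi x| <= C * chi a b x.
Proof.
move=> tphi; have cphi := test_continuous tphi; have [_ [M HM]] := tphi.
pose N := `|M| + 1.
have cpt : compact (phi @` `[- N, N]).
  by apply: continuous_compact; [exact: continuous_subspaceT|exact: segment_compact].
have [B [_ HB]] := compact_bounded cpt.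
have N1 : 1 <= N by rewrite /N lerDr.
have MN : M < N by rewrite /N; have := ler_norm M; lra.
(* The bound holds on [-N, N]; the right end [N + 1] brings the point [N] into the half-open
   interval. *)
exists (B + 1), (- N), (N + 1); split; first by lra.
move=> x; have [xN|Nx] := leP `|x| N.
  have /andP[x1 x2] : - N <= x <= N by rewrite -ler_norml.
  rewrite chiE x1 (le_lt_trans x2) ?mulr1 ?ltrDl//.
  by apply: HB; [lra|exists x => //; rewrite /= in_itv/= x1 x2].
have /andP[c0 _] := chi_itv01 (- N) (N + 1) x.
rewrite HM ?(lt_trans MN Nx)// normr0 mulr_ge0//.
have : `|phi 0| <= B + 1.
  by apply: HB; [lra|exists 0 => //; rewrite /= in_itv/=; apply/andP; split; lra].
exact: le_trans.
Qed.

Lemma intg_mul_test f phi : loc_integrable f -> test_fun phi -> intg (fun x => f x * phi x).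
Proof.
move=> lf tphi; have [C [a [b [ab H]]]] := test_bound tphi.
apply: (intg_dom _ (intgZ C (intg_norm (intg_mul_chi a b lf)))).
  apply: measurable_funM; first exact: lf.1.
  by apply: continuous_measurable_fun; exact: test_continuous.
move=> x; rewrite !normrM mulrCA ler_wpM2l//.
by rewrite (ger0_norm (proj1 (andP (chi_itv01 a b x)))); exact: H.
Qed.

(** All pairings with test functions are finite, so the identity between extended integrals can be
    replaced by one between real numbers and rearranged freely. *)
Lemma is_weak_derivP f g : loc_integrable f -> loc_integrable g ->
  is_weak_deriv f g <->
  forall phi, test_fun phi -> I (fun x => f x * derive1 phi x) = - I (fun x => g x * phi x).
Proof.
move=> lf lg; split=> [[_ [_ H]] phi tphi|H].
  have := H _ tphi; rewrite !EFin_I ?EFinN; first by case.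
    exact: intg_mul_test.
  by apply: intg_mul_test => //; exact: test_derive.
split=> //; split=> // phi tphi.
rewrite !EFin_I ?H//; first exact: intg_mul_test.
by apply: intg_mul_test => //; exact: test_derive.
Qed.

Lemma is_weak_deriv_lin a b f1 f2 g1 g2 : is_weak_deriv f1 g1 -> is_weak_deriv f2 g2 ->
  is_weak_deriv (fun x => a * f1 x + b * f2 x) (fun x => a * g1 x + b * g2 x).
Proof.
move=> H1 H2; have [lf1 [lg1 _]] := H1; have [lf2 [lg2 _]] := H2.
have P1 := (is_weak_derivP lf1 lg1).1 H1; have P2 := (is_weak_derivP lf2 lg2).1 H2.
apply/is_weak_derivP; try exact: loc_integrable_lin.
move=> phi tphi; have tphi' := test_derive tphi.
have := I_lin a b (intg_mul_test lf1 tphi') (intg_mul_test lf2 tphi').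
have := I_lin a b (intg_mul_test lg1 tphi) (intg_mul_test lg2 tphi).
rewrite P1// P2// => E1 E2.
transitivity (- (a * I (fun x => g1 x * phi x) + b * I (fun x => g2 x * phi x))).
  by rewrite opprD -!mulrN -E2; apply: eq_Rintegral => x _; ring.
by rewrite -E1; congr (- _); apply: eq_Rintegral => x _; ring.
Qed.

End WeakDerivative.

(** * Weak derivatives *)


Section StepKernel.
Context {R : realType}.
Local Notation mu := (@lebesgue_measure R).
Local Notation I f := (Rintegral mu setT f).
Local Notation L2 := (L2_on setT).
Implicit Types (f g h k phi : R -> R) (a b x y e : R).

Lemma cvg_const_seq_le (u : nat -> R) (l C : R) :
  (forall n, `|u n - l| <= C / n.+1%:R) -> u @ \oo --> l.
Proof.
move=> H; apply/cvgrPdist_le => e e0.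
have C1 : 0 < `|C| + 1 by rewrite ltr_wpDl.
near=> n; rewrite distrC (le_trans (H n))//.
rewrite ler_pdivrMr ?ltr0n// (le_trans (ler_norm C))//.
have : (`|C| + 1) / e <= n.+1%:R.
  apply: (@le_trans _ _ n%:R); last by rewrite ler_nat.
  by near: n; exact: nbhs_infty_ger.
rewrite ler_pdivrMr// mulrC; lra.
Unshelve. all: by end_near. Qed.

Variable psi : R -> R.
Hypothesis (spsi : smooth psi) (psi_le0 : forall x, x <= 0 -> psi x = 0)
  (psi_ge1 : forall x, 1 <= x -> psi x = 1) (psi01 : forall x, 0 <= psi x <= 1).
Variable C : R.
Hypothesis (psiC : forall x, `|derive1 psi x| <= C).

(** The rise from 0 to 1 takes place on [a, a + e]. The argument (x - a)/e is kept in the shape c x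
    + d of the lemmas on affine composition. *)
Definition step a e x := psi (e^-1 * x + - (e^-1 * a)).
Definition kern a e x := e^-1 * derive1 psi (e^-1 * x + - (e^-1 * a)).

Lemma step_arg a e x : e^-1 * x + - (e^-1 * a) = (x - a) / e.
Proof. by rewrite -mulrBr mulrC. Qed.

Lemma is_derive_step a e x : is_derive x 1 (step a e) (kern a e x).
Proof.
have := derivable_is_derive1 (@smooth_derivable _ _ spsi (e^-1 * x + - (e^-1 * a))).
exact: is_derive1_affine_comp.
Qed.

Lemma step_le a e x : 0 < e -> x <= a -> step a e x = 0.
Proof.
move=> e0 xa; rewrite /step step_arg psi_le0//.
by rewrite pmulr_lle0 ?invr_gt0// subr_le0.
Qed.

Lemma step_ge a e x : 0 < e -> a + e <= x -> step a e x = 1.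
Proof.
move=> e0 xa; rewrite /step step_arg psi_ge1//.
by rewrite ler_pdivlMr// mul1r; lra.
Qed.

Lemma smooth_stepf a e : smooth (step a e).
Proof. exact: (@smooth_comp_affine R psi e^-1 (- (e^-1 * a)) spsi). Qed.

Lemma derive1_step a e : derive1 (step a e) = kern a e.
Proof. by apply/funext => x; exact: (is_derive1E (is_derive_step a e x)). Qed.

Lemma kern_out a e x : 0 < e -> x < a \/ a + e < x -> kern a e x = 0.
Proof.
move=> e0 H; rewrite -derive1_step; apply: is_derive1E.
case: H => xa.
  apply: (@is_derive1_near _ (fun=> 0)); near=> y; rewrite step_le//.
  by apply: ltW; near: y; exact: lt_nbhsl.
apply: (@is_derive1_near _ (fun=> 1)); near=> y; rewrite step_ge//.
by apply: ltW; near: y; exact: lt_nbhsr.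
Unshelve. all: by end_near. Qed.

Lemma smooth_kern a e : smooth (kern a e).
Proof. by rewrite -derive1_step; apply: smooth_derive; exact: smooth_stepf. Qed.

Lemma test_kern a e : 0 < e -> test_fun (kern a e).
Proof.
move=> e0; split; first exact: smooth_kern.
exists (`|a| + e) => x; rewrite lter_normr => /orP[] H; apply: kern_out => //.
  by right; rewrite (le_lt_trans _ H)// lerD2r ler_norm.
by left; have := ler_norm (- a); rewrite normrN; lra.
Qed.

Lemma derive1_bound_ge0 : 0 <= C.
Proof. exact: le_trans (normr_ge0 _) (psiC 0). Qed.

(* The radius [2 e] rather than [e] absorbs the endpoint excluded by [chi]. *)
Lemma kern_bound a e x : 0 < e ->
  `|kern a e x| <= (C * 2) / (e * 2) * chi (a - e * 2) (a + e * 2) x.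
Proof.
move=> e0.
have -> : C * 2 / (e * 2) = C / e by field; exact: lt0r_neq0.
have R0 : 0 <= C / e * chi (a - e * 2) (a + e * 2) x.
  have /andP[c0 _] := chi_itv01 (a - e * 2) (a + e * 2) x.
  by rewrite !mulr_ge0 ?derive1_bound_ge0 ?invr_ge0 ?(ltW e0).
have [xa|ax] := ltP x a; first by rewrite kern_out ?normr0//; left.
have [xa|xa] := ltP (a + e) x; first by rewrite kern_out ?normr0//; right.
rewrite chiE (_ : (_ <= _ < _)%R = true); last by apply/andP; split; lra.
rewrite mulr1 normrM ger0_norm ?invr_ge0 ?(ltW e0)// mulrC.
by apply: ler_wpM2r; [rewrite invr_ge0 ltW|exact: psiC].
Qed.

(** The integral of the kernel is the total rise of the step. The indicator of an interval
    containing the support is inserted to reach the fundamental theorem on a bounded interval. *)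
Lemma I_kern a e : 0 < e -> I (kern a e) = 1.
Proof.
move=> e0.
have -> : kern a e = (fun x => kern a e x * chi (a - e) (a + e * 2) x).
  apply/funext => x; rewrite chiE; have [_|] := boolP (a - e <= x < a + e * 2); first by rewrite mulr1.
  rewrite negb_and -ltNge -leNgt => /orP[] H; rewrite mulr0 kern_out//.
    by left; lra.
  by right; lra.
rewrite (FTC_chi _ _ (is_derive_step a e)).
- by rewrite step_ge ?step_le ?subr0//; lra.
- by lra.
- by apply: derivable_continuous; apply: smooth_derivable; exact: smooth_kern.
Qed.

(* Squared, so that Cauchy-Schwarz on intervals of length [eps n] yields O(1/n). *)
Definition eps (n : nat) : R := n.+1%:R^-1 ^+ 2.

Lemma eps_gt0 n : 0 < eps n.
Proof. by rewrite exprn_gt0// invr_gt0 ltr0n. Qed.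

Lemma eps_cvg0 : eps @ \oo --> (0:R).
Proof.
apply: (@cvg_const_seq_le _ _ 1) => n; rewrite subr0 (ger0_norm (ltW (eps_gt0 n))) mul1r.
rewrite /eps expr2 ler_piMr ?invr_ge0//.
by rewrite invf_le1 ?ltr0n// ler1n.
Qed.

Lemma kern_cvg h x : loc_integrable h -> lebesgue_pt h x ->
  (fun n => I (fun y => h y * kern x (eps n) y)) @ \oo --> h x.
Proof.
move=> lh hx; apply: (@kernel_cvg _ h x _ (fun n => eps n * 2) (C * 2)) => //.
- by rewrite mulr_ge0// derive1_bound_ge0.
- by move=> n; rewrite mulr_gt0// eps_gt0.
- by rewrite -[X in _ --> X](mul0r 2); apply: cvgMl; exact: eps_cvg0.
- move=> n; apply: continuous_measurable_fun; apply: derivable_continuous.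
  by apply: smooth_derivable; exact: smooth_kern.
- by move=> n y; apply: kern_bound; exact: eps_gt0.
- by move=> n; apply: I_kern; exact: eps_gt0.
Qed.

(** The kernels at [x] are test functions, so [g1] and [g2] have the same integrals against them; at
    a common Lebesgue point these integrals tend to [g1 x] and [g2 x]. *)
Lemma weak_deriv_unique_aux f g1 g2 :
  is_weak_deriv f g1 -> is_weak_deriv f g2 -> {ae mu, forall x, g1 x = g2 x}.
Proof.
move=> H1 H2; have [lf [lg1 _]] := H1; have [_ [lg2 _]] := H2.
have P1 := (is_weak_derivP lf lg1).1 H1; have P2 := (is_weak_derivP lf lg2).1 H2.
apply: ae2 (ae_lebesgue_pt lg1) (ae_lebesgue_pt lg2) => x x1 x2.
have c1 := kern_cvg lg1 x1; have c2 := kern_cvg lg2 x2.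
have E : (fun n => I (fun y => g1 y * kern x (eps n) y)) =
         (fun n => I (fun y => g2 y * kern x (eps n) y)).
  apply/funext => n; have tk := test_kern x (eps_gt0 n).
  by apply: oppr_inj; rewrite -P1// -P2.
by rewrite E in c1; exact: (cvg_unique _ c1 c2).
Qed.

Lemma step_chi a b e x : 0 < e -> a <= b ->
  `|(step a e x - step b e x) - chi a b x| <= chi a (a + e) x + chi b (b + e) x.
Proof.
move=> e0 ab.
(* [s] is the amount by which the step lags behind the Heaviside function at [c]; it lives on the
   transition interval. *)
have H c : exists2 s : R, step c e x = (c <= x)%R%:R - s & 0 <= s <= chi c (c + e) x.
  exists ((c <= x)%R%:R - step c e x); first by rewrite subKr.
  have [cx|xc] := leP c x; last by rewrite step_le ?(ltW xc)// subrr lexx/= ; have /andP[] := chi_itv01 c (c + e) x.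
  have [xe|ex] := ltP x (c + e).
    rewrite chiE cx xe/=; have /andP[] := psi01 (e^-1 * x + - (e^-1 * c)).
    by rewrite -/(step c e x) => s0 s1; apply/andP; split; lra.
  by rewrite step_ge// subrr lexx; have /andP[] := chi_itv01 c (c + e) x.
have [s -> /andP[s0 s1]] := H a; have [t -> /andP[t0 t1]] := H b.
have -> : chi a b x = (a <= x)%R%:R - (b <= x)%R%:R.
  rewrite chiE; have [bx|xb] := leP b x; last by rewrite andbT subr0.
  by rewrite (le_trans ab bx) subrr.
by rewrite ler_norml; apply/andP; split; lra.
Qed.

(** Test with the difference of the steps at [a] and [b]. Its derivative is a difference of kernels,
    which recovers [f a - f b] at Lebesgue points; the test function itself differs from [chi a b]
    only on two transition intervals of length [eps n], where Cauchy-Schwarz makes the integral of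
    |g| small. *)
Lemma weak_deriv_ftc_aux f g a b : is_weak_deriv f g -> L2 g -> a <= b ->
  lebesgue_pt f a -> lebesgue_pt f b -> f b - f a = I (fun x => g x * chi a b x).
Proof.
move=> H Lg ab fa fb; have [lf [lg _]] := H.
have P := (is_weak_derivP lf lg).1 H.
have ca := kern_cvg lf fa; have cb := kern_cvg lf fb.
pose phi n x := 1 * step a (eps n) x + (-1) * step b (eps n) x.
have tphi n : test_fun (phi n).
  split; first by apply: smooth_lin; exact: smooth_stepf.
  exists (`|a| + `|b| + eps n) => x; have e0 := eps_gt0 n.
  have := ler_norm a; have := ler_norm b; have := ler_norm (- a); have := ler_norm (- b).
  have := normr_ge0 a; have := normr_ge0 b; rewrite !normrN => ? ? ? ? ? ?.
  rewrite lter_normr => /orP[] ?.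
    by rewrite /phi !step_ge//; lra.
  by rewrite /phi !step_le//; lra.
have phi' n : derive1 (phi n) = (fun x => 1 * kern a (eps n) x + (-1) * kern b (eps n) x).
  apply/funext => x; apply: is_derive1E; apply: is_derive1_lin; exact: is_derive_step.
have E n : I (fun x => f x * kern a (eps n) x) - I (fun x => f x * kern b (eps n) x) =
    - I (fun x => g x * phi n x).
  rewrite -P// phi' -IB; last 2 first.
    by apply: intg_mul_test => //; apply: test_kern; exact: eps_gt0.
    by apply: intg_mul_test => //; apply: test_kern; exact: eps_gt0.
  by apply: eq_Rintegral => x _; ring.
have L1 : (fun n => I (fun x => f x * kern a (eps n) x) - I (fun x => f x * kern b (eps n) x))
   @ \oo --> f a - f b by apply: cvgB.
set G := I (fun x => g x ^+ 2).
have G0 : 0 <= G by apply: I_ge0 => x; exact: sqr_ge0.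
have L2' : (fun n => - I (fun x => g x * phi n x)) @ \oo --> - I (fun x => g x * chi a b x).
  apply: cvgN; apply: (@cvg_const_seq_le _ _ ((G + 1) * 2)) => n.
  have e0 := eps_gt0 n.
  (* Cauchy-Schwarz gives sqrt(G) / (n + 1); the larger [G + 1] replaces the root, since G <= (G +
     1)^2. *)
  have small c : I (fun x => `|g x| * chi c (c + eps n) x) <= (G + 1) / n.+1%:R.
    have Lg' : L2 (fun x => `|g x|).
      split; first by apply: measurableT_comp => //; exact: Lg.1.
      by apply: (intg_ext _ Lg.2) => x; rewrite real_normK// num_real.
    have cc : c <= c + eps n by lra.
    have := I_chi_sqr cc Lg'.
    have S : I (fun x => `|g x| ^+ 2 * chi c (c + eps n) x) <= G.
      apply: I_le; [|exact: Lg.2|].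
        by apply: (intg_ext _ (L2_mul_chi c (c + eps n) Lg).2) => x;
          rewrite exprMn chi_sqr real_normK// num_real.
      move=> x; rewrite real_normK ?num_real// ler_piMr ?sqr_ge0//.
      by have /andP[] := chi_itv01 c (c + eps n) x.
    rewrite addrAC subrr add0r => H1.
    have G1 : 0 <= (G + 1) / n.+1%:R by rewrite divr_ge0//; lra.
    rewrite -ler_sqr ?nnegrE//; last first.
      by apply: I_ge0 => x; rewrite mulr_ge0//; have /andP[] := chi_itv01 c (c + eps n) x.
    rewrite (le_trans H1)// (le_trans (ler_wpM2l (ltW e0) S))// exprMn mulrC /eps.
    by rewrite ler_wpM2r ?sqr_ge0//; nra.
  have Ic c : intg (fun x => `|g x| * chi c (c + eps n) x).
    apply: (intg_ext _ (intg_norm (intg_mul_chi c (c + eps n) lg))) => x.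
    by rewrite normrM (ger0_norm (proj1 (andP (chi_itv01 c (c + eps n) x)))).
  rewrite -IB; [|exact: intg_mul_test|exact: intg_mul_chi].
  apply: (@le_trans _ _ (I (fun x => `|g x| * chi a (a + eps n) x) + I (fun x => `|g x| * chi b (b + eps n) x))).
    rewrite -(RintegralD measurableT (Ic a) (Ic b)); apply: I_abs_le.
    - by apply: intgB; [exact: intg_mul_test|exact: intg_mul_chi].
    - exact: (intgD (Ic a) (Ic b)).
    - move=> x; rewrite -mulrBr normrM -mulrDr ler_wpM2l//.
      by rewrite /phi mul1r mulN1r; exact: step_chi.
  rewrite (mulrAC (G + 1)) mulr_natr mulr2n; exact: lerD.
rewrite (_ : (fun n => _) = (fun n => - I (fun x => g x * phi n x))) in L1; last exact/funext.
by rewrite -[RHS]opprK -(cvg_unique _ L1 L2') ?opprB.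
Qed.

End StepKernel.

Section WeakDerivativeTheory.
Context {R : realType}.
Local Notation mu := (@lebesgue_measure R).
Local Notation I f := (Rintegral mu setT f).
Local Notation L2 := (L2_on setT).
Implicit Types (f g h k phi : R -> R) (a b x y e : R).

Lemma weak_deriv_unique f g1 g2 :
  is_weak_deriv f g1 -> is_weak_deriv f g2 -> {ae mu, forall x, g1 x = g2 x}.
Proof.
have [psi [spsi p0 p1 p01 [C HC]]] := @smooth_step R.
exact: (weak_deriv_unique_aux spsi p0 p1 HC).
Qed.

Lemma weak_deriv_ftc f g a b : is_weak_deriv f g -> L2 g -> a <= b ->
  lebesgue_pt f a -> lebesgue_pt f b -> f b - f a = I (fun x => g x * chi a b x).
Proof.
have [psi [spsi p0 p1 p01 [C HC]]] := @smooth_step R.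
exact: (weak_deriv_ftc_aux spsi p0 p1 p01 HC).
Qed.

End WeakDerivativeTheory.

(** * Continuous representatives in H^1 *)


Section Primitive.
Context {R : realType}.
Local Notation mu := (@lebesgue_measure R).
Local Notation I f := (Rintegral mu setT f).
Local Notation L2 := (L2_on setT).
Implicit Types (f g h r : R -> R) (a b x y e : R).

(** Formulated through increments, so that no base point is singled out and constants may be
    added. *)
Definition primitive_of h r :=
  forall a b, a <= b -> r b - r a = I (fun x => h x * chi a b x).

Lemma I_chi_split h a b c : loc_integrable h -> a <= b -> b <= c ->
  I (fun x => h x * chi a c x) = I (fun x => h x * chi a b x) + I (fun x => h x * chi b c x).
Proof.
move=> lh ab bc; rewrite -RintegralD//; try exact: intg_mul_chi.
by apply: eq_Rintegral => x _; rewrite (chi_split x ab bc) mulrDr.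
Qed.

Lemma primitive_exists h : loc_integrable h -> exists r, primitive_of h r.
Proof.
move=> lh; pose J a b := I (fun x => h x * chi a b x).
have JD a b c : a <= b -> b <= c -> J a c = J a b + J b c by exact: I_chi_split.
exists (fun x => if 0 <= x then J 0 x else - J x 0) => a b ab; rewrite -/(J a b).
case: (lerP 0 a) => a0; case: (lerP 0 b) => b0.
- by rewrite (JD 0 a b)//; ring.
- by have := le_lt_trans (le_trans a0 ab) b0; rewrite ltxx.
- by rewrite (JD a 0 b)// ?ltW//; ring.
- by rewrite (JD a b 0)// ?ltW//; ring.
Qed.

Lemma primitive_sqr h r a b : L2 h -> primitive_of h r -> a <= b ->
  (r b - r a) ^+ 2 <= (b - a) * I (fun x => h x ^+ 2 * chi a b x).
Proof. by move=> Lh rh ab; rewrite rh//; exact: I_chi_sqr. Qed.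

Lemma intg_sqr_chi h a b : L2 h -> intg (fun x => h x ^+ 2 * chi a b x).
Proof.
move=> Lh; apply: (intg_ext _ (L2_mul_chi a b Lh).2) => x.
by rewrite exprMn chi_sqr.
Qed.

Lemma I_sqr_chi_le h a b : L2 h -> I (fun x => h x ^+ 2 * chi a b x) <= I (fun x => h x ^+ 2).
Proof.
move=> Lh; apply: I_le; [exact: intg_sqr_chi|exact: Lh.2|move=> x].
by rewrite ler_piMr ?sqr_ge0//; have /andP[] := chi_itv01 a b x.
Qed.

(** Hölder continuity of exponent 1/2, squared to avoid roots. *)
Lemma primitive_holder h r a b : L2 h -> primitive_of h r ->
  (r b - r a) ^+ 2 <= `|b - a| * I (fun x => h x ^+ 2).
Proof.
move=> Lh rh; wlog ab : a b / a <= b.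
  move=> H; have [/H//|/ltW/H] := leP a b.
  by rewrite distrC -sqrrN opprB.
rewrite (le_trans (primitive_sqr Lh rh ab))// ger0_norm ?subr_ge0//.
by rewrite ler_wpM2l ?subr_ge0// I_sqr_chi_le.
Qed.

Lemma primitive_continuous h r : L2 h -> primitive_of h r -> continuous r.
Proof.
move=> Lh rh x; apply/cvgrPdist_le => e e0.
set G := I (fun x => h x ^+ 2).
have G0 : 0 <= G by apply: I_ge0 => y; exact: sqr_ge0.
have G1 : 0 < G + 1 by lra.
near=> y.
have xy : `|x - y| <= e ^+ 2 / (G + 1).
  by near: y; apply: (@cvgr_dist_le _ _ _ _ _ id x) => //; rewrite divr_gt0// exprn_gt0.
rewrite -(@ler_pXn2r _ 2)// ?nnegrE ?(ltW e0)// real_normK ?num_real//.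
rewrite (le_trans (primitive_holder _ _ Lh rh))// -/G.
apply: (@le_trans _ _ (e ^+ 2 / (G + 1) * G)); first by rewrite ler_wpM2r.
by rewrite mulrAC ler_pdivrMr// ler_wpM2l ?sqr_ge0//; lra.
Unshelve. all: by end_near. Qed.

(** The difference quotient is the integral of [h] against the normalised indicator of an interval
    that contains [x] but need not be centred there. That interval lies within distance [d n] of
    [x], so the kernel estimate applies with radius [2 d n] and constant 2. *)
Lemma slope_cvg h r x (a d : nat -> R) : loc_integrable h -> primitive_of h r ->
  lebesgue_pt h x -> (forall n, 0 < d n) -> d @ \oo --> (0:R) ->
  (forall n, a n <= x < a n + d n) ->
  (fun n => (r (a n + d n) - r (a n)) / d n) @ \oo --> h x.
Proof.
move=> lh rh hx d0 dcvg ax.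
pose k n y := (d n)^-1 * chi (a n) (a n + d n) y.
have -> : (fun n => (r (a n + d n) - r (a n)) / d n) = (fun n => I (fun y => h y * k n y)).
  apply/funext => n; rewrite rh; last by rewrite lerDl ltW.
  rewrite mulrC -IZ; last exact: intg_mul_chi.
  by apply: eq_Rintegral => y _; rewrite mulrCA.
apply: (@kernel_cvg _ h x k (fun n => d n * 2) 2) => //.
- by move=> n; rewrite mulr_gt0.
- by rewrite -[X in _ --> X](mul0r 2); apply: cvgMl.
- by move=> n; apply: measurable_funM => //; exact: measurable_chi.
- move=> n y; have dn := d0 n; have /andP[a1 a2] := ax n.
  have -> : 2 / (d n * 2) = (d n)^-1 by field; exact: lt0r_neq0.
  rewrite /k normrM (ger0_norm (ltW _)) ?invr_gt0// ler_wpM2l ?invr_ge0 ?(ltW dn)//.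
  rewrite ger0_norm; last by have /andP[] := chi_itv01 (a n) (a n + d n) y.
  rewrite [X in X <= _]chiE; have [/andP[y1 y2]|_] := boolP (a n <= y < a n + d n).
    by rewrite chiE (_ : (_ <= _ < _)%R = true)//; apply/andP; split; lra.
  by have /andP[] := chi_itv01 (x - d n * 2) (x + d n * 2) y.
- move=> n; have dn := d0 n; rewrite IZ; last exact: intg_chi.
  by rewrite I_chi ?lerDl ?(ltW dn)// addrAC subrr add0r mulVf// lt0r_neq0.
Qed.

End Primitive.

Section Representative.
Context {R : realType}.
Local Notation mu := (@lebesgue_measure R).
Local Notation I f := (Rintegral mu setT f).
Local Notation L2 := (L2_on setT).
Implicit Types (f g h r : R -> R) (a b x y e : R).

Lemma L2_ae f g : measurable_fun setT g -> {ae mu, forall x, f x = g x} -> L2 f -> L2 g.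
Proof.
move=> mg fg [mf If]; split => //.
by apply: intg_ae If; [exact: measurable_funX|apply: ae1 fg => x ->].
Qed.

Lemma wderiv_spec f g : is_weak_deriv f g -> is_weak_deriv f (wderiv f).
Proof.
move=> H; rewrite /wderiv; case: pselect => [H'|[]]; last by exists g.
exact: (projT2 (cid H')).
Qed.

Lemma wderiv_ae f g : is_weak_deriv f g -> {ae mu, forall x, wderiv f x = g x}.
Proof. by move=> H; exact: weak_deriv_unique (wderiv_spec H) H. Qed.

Lemma H1_wderiv f : H1 f -> is_weak_deriv f (wderiv f).
Proof. by move=> [_ [g [H _]]]; exact: wderiv_spec H. Qed.

Lemma H1_wderiv_L2 f : H1 f -> L2 (wderiv f).
Proof.
move=> Hf; have [_ [g [H Lg]]] := Hf.
have [_ [[mw _] _]] := H1_wderiv Hf.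
by apply: L2_ae Lg => //; apply: ae1 (wderiv_ae H) => x ->.
Qed.

(** Anchor a primitive of the weak derivative at one Lebesgue point [x0] of [f]. The fundamental
    theorem between Lebesgue points then identifies it with [f] at all of them. *)
Lemma H1_rep f : H1 f -> exists r,
  {ae mu, forall x, f x = r x} /\ primitive_of (wderiv f) r.
Proof.
move=> Hf; have Lw := H1_wderiv_L2 Hf; have Hw := H1_wderiv Hf.
have [lf [lw _]] := Hw.
have [r0 Hr0] := primitive_exists lw.
have aelp := ae_lebesgue_pt lf.
have [x0 _ fx0] := @ae_dense R _ 0 1 ltr01 aelp.
exists (fun x => f x0 + (r0 x - r0 x0)); split; last first.
  by move=> a b ab; rewrite -Hr0//; ring.
apply: ae1 aelp => x fx; have [xx0|/ltW xx0] := leP x0 x.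
  by have := weak_deriv_ftc Hw Lw xx0 fx0 fx; rewrite -Hr0//; lra.
by have := weak_deriv_ftc Hw Lw xx0 fx fx0; rewrite -Hr0//; lra.
Qed.

(* Junk value [0] when [f] has no continuous representative. *)
Definition rep f : R -> R :=
  xget (fun=> 0) [set r | continuous r /\ {ae mu, forall x, f x = r x}].

Lemma repP f r : continuous r -> {ae mu, forall x, f x = r x} -> rep f = r.
Proof.
move=> cr fr; have [cx fx] : continuous (rep f) /\ {ae mu, forall x, f x = rep f x}.
  by apply: (@xgetPex _ _ [set r | continuous r /\ {ae mu, forall x, f x = r x}]); exists r.
by apply: continuous_ae_eq => //; apply: ae2 fx fr => x <-.
Qed.

Lemma rep_spec f : H1 f -> [/\ continuous (rep f), {ae mu, forall x, f x = rep f x}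
  & primitive_of (wderiv f) (rep f)].
Proof.
move=> Hf; have [r [fr pr]] := H1_rep Hf.
have cr := primitive_continuous (H1_wderiv_L2 Hf) pr.
by rewrite (repP cr fr).
Qed.

Lemma H1_lin a f g : H1 f -> H1 g -> H1 (fun x => a * f x + g x).
Proof.
move=> Hf Hg; split.
  by apply: L2_ext (L2_lin a 1 Hf.1 Hg.1) => x; rewrite mul1r.
exists (fun x => a * wderiv f x + 1 * wderiv g x); split.
  have := is_weak_deriv_lin a 1 (H1_wderiv Hf) (H1_wderiv Hg).
  by rewrite (_ : (fun x => a * f x + 1 * g x) = (fun x => a * f x + g x))//;
    apply/funext => x; rewrite mul1r.
by apply: L2_lin; exact: H1_wderiv_L2.
Qed.

Lemma wderiv_lin a f g : H1 f -> H1 g ->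
  {ae mu, forall x, wderiv (fun x => a * f x + g x) x = a * wderiv f x + wderiv g x}.
Proof.
move=> Hf Hg; apply: wderiv_ae.
have := is_weak_deriv_lin a 1 (H1_wderiv Hf) (H1_wderiv Hg).
rewrite (_ : (fun x => a * f x + 1 * g x) = (fun x => a * f x + g x)); last first.
  by apply/funext => x; rewrite mul1r.
rewrite (_ : (fun x => a * wderiv f x + 1 * wderiv g x) = (fun x => a * wderiv f x + wderiv g x))//.
by apply/funext => x; rewrite mul1r.
Qed.

Lemma H1norm_ge0 f : 0 <= H1norm f.
Proof. exact: sqrtr_ge0. Qed.

Lemma H1norm_sqr f : H1norm f ^+ 2 = I (fun x => f x ^+ 2) + I (fun x => wderiv f x ^+ 2).
Proof.
by rewrite sqr_sqrtr// addr_ge0// I_ge0// => x; exact: sqr_ge0.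
Qed.

Lemma rep_lin a f g : H1 f -> H1 g ->
  rep (fun x => a * f x + g x) = (fun x => a * rep f x + rep g x).
Proof.
move=> Hf Hg; have [cf ff _] := rep_spec Hf; have [cg gg _] := rep_spec Hg.
apply: repP; last by apply: ae2 ff gg => x -> ->.
by move=> x; apply: cvgD; [apply: cvgMr; exact: cf|exact: cg].
Qed.

(* Compare [rep f x] with [rep f y] and average over [y] in [x, x + 1[. *)
Lemma rep_bound f x : H1 f -> `|rep f x| <= 2 * H1norm f.
Proof.
move=> Hf; have [cr fr pr] := rep_spec Hf; have Lw := H1_wderiv_L2 Hf.
have Lr : L2 (rep f) by apply: L2_ae Hf.1 => //; exact: continuous_measurable_fun.
set G := I (fun x => wderiv f x ^+ 2).
have FE : I (fun x => f x ^+ 2) = I (fun x => rep f x ^+ 2).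
  apply: I_ae; [by apply: measurable_funX; exact: Hf.1.1|by apply: measurable_funX; exact: Lr.1|].
  by apply: ae1 fr => y ->.
have Ic : I (chi x (x + 1)) = 1 by rewrite I_chi; lra.
have H : I (fun y => rep f x ^+ 2 * chi x (x + 1) y) <=
    I (fun y => 2 * rep f y ^+ 2 + 2 * G * chi x (x + 1) y).
  apply: I_le; [by apply: intgZ; exact: intg_chi|exact: (intg_lin 2 (2 * G) Lr.2 (intg_chi x (x + 1)))|move=> y].
  rewrite chiE; have [/andP[y1 y2]|_] := boolP (x <= y < x + 1); last first.
    by rewrite !mulr0 addr0 mulr_ge0// sqr_ge0.
  rewrite !mulr1; have := primitive_holder y x Lw pr; rewrite -/G => Hh.
  have G0 : 0 <= G by apply: I_ge0 => z; exact: sqr_ge0.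
  have xy : `|x - y| <= 1 by rewrite ler_norml; apply/andP; split; lra.
  (* The square (a - 2b)^2 >= 0 is the inequality a^2 <= 2 b^2 + 2 (a - b)^2. *)
  have := ler_wpM2r G0 xy; have := sqr_ge0 (rep f x - 2 * rep f y); nra.
rewrite (IZ _ (intg_chi x (x + 1))) (I_lin 2 (2 * G) Lr.2 (intg_chi x (x + 1))) Ic !mulr1 in H.
rewrite -(@ler_pXn2r _ 2)// ?nnegrE ?mulr_ge0 ?H1norm_ge0// real_normK ?num_real//.
rewrite exprMn H1norm_sqr FE -/G (le_trans H)//.
have G0 : 0 <= G by apply: I_ge0 => z; exact: sqr_ge0.
have F0 : 0 <= I (fun x => rep f x ^+ 2) by apply: I_ge0 => z; exact: sqr_ge0.
nra.
Qed.

Lemma eval_dual x : H1_dual (fun f => rep f x).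
Proof.
split; first by move=> a f g Hf Hg; rewrite rep_lin.
by exists 2 => f; exact: rep_bound.
Qed.

Lemma pairing_dual h : L2 h -> H1_dual (fun f => I (fun x => h x * wderiv f x)).
Proof.
move=> Lh; split.
  move=> a f g Hf Hg; have Lf := H1_wderiv_L2 Hf; have Lg := H1_wderiv_L2 Hg.
  have Lfg := H1_wderiv_L2 (H1_lin a Hf Hg).
  transitivity (I (fun x => h x * (a * wderiv f x + wderiv g x))).
    apply: I_ae.
    - by apply: measurable_funM; [exact: Lh.1|exact: Lfg.1].
    - apply: measurable_funM; [exact: Lh.1|apply: measurable_funD; last exact: Lg.1].
      by apply: measurable_funM => //; exact: Lf.1.
    - by apply: ae1 (wderiv_lin a Hf Hg) => x ->.
  rewrite -[X in _ + X]mul1r -(I_lin a 1 (L2_mul Lh Lf) (L2_mul Lh Lg)).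
  by apply: eq_Rintegral => x _; ring.
(* For T the integral of h^2, [T + 1] serves as constant in place of sqrt(T), since T <= (T +
   1)^2. *)
exists (I (fun x => h x ^+ 2) + 1) => f Hf.
have H0 : 0 <= I (fun x => h x ^+ 2) by apply: I_ge0 => x; exact: sqr_ge0.
rewrite -(@ler_pXn2r _ 2)// ?nnegrE; last by rewrite mulr_ge0 ?H1norm_ge0//; lra.
rewrite real_normK ?num_real// (le_trans (cauchy_schwarz Lh (H1_wderiv_L2 Hf)))//.
rewrite exprMn H1norm_sqr.
have F0 : 0 <= I (fun x => f x ^+ 2) by apply: I_ge0 => z; exact: sqr_ge0.
have G0 : 0 <= I (fun x => wderiv f x ^+ 2) by apply: I_ge0 => z; exact: sqr_ge0.
apply: ler_pM => //; last by lra.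
by rewrite expr2; nra.
Qed.

End Representative.

(** * Lower semicontinuity *)


Section LimInf.
Context {R : realType}.
Implicit Types u v : (\bar R)^nat.
Local Open Scope ereal_scope.

Lemma le_limn_einf_near u v : (\forall n \near \oo, u n <= v n) ->
  limn_einf u <= limn_einf v.
Proof.
move=> [N _ uv]; rewrite !limn_einf_lim.
apply: lee_lim; [exact: is_cvg_einfs|exact: is_cvg_einfs|].
exists N => // n /= Nn; apply: le_ereal_inf_tmp => _ [k /= nk <-].
apply: (@le_trans _ _ (u k)); last by apply: uv; exact: leq_trans nk.
by apply: ereal_inf_lbound; exists k.
Qed.

Lemma limn_esup_le_cvg_near u v l : (\forall n \near \oo, u n <= v n) ->
  v @ \oo --> l -> limn_esup u <= l.
Proof.
move=> uv /cvg_limn_einf_sup[_ <-].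
rewrite -leeN2 -!limn_einfN; apply: le_limn_einf_near.
by near=> n; rewrite /= leeN2; near: n.
Unshelve. all: by end_near. Qed.

(** Eventually [b n >= l - e], and a finite constant can be moved out of a lower limit. *)
Lemma limn_einfD_cvg (b : R^nat) (l : R) u : b @ \oo --> l ->
  l%:E + limn_einf u <= limn_einf (fun n => (b n)%:E + u n).
Proof.
move=> bl; apply/lee_addgt0Pr => e e0.
rewrite -leeBlDr//.
rewrite (_ : l%:E + limn_einf u - e%:E = limn_einf (fun n => (l - e)%:E + u n)).
  apply: le_limn_einf_near; near=> n; rewrite leeD2r// lee_fin.
  have : (`|l - b n| <= e)%R by near: n; exact: (cvgr_dist_le _ _ bl).
  by rewrite ler_norml => /andP[]; lra.
by rewrite limn_einf_shift// EFinB addeAC.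
Unshelve. all: by end_near. Qed.

End LimInf.

Section SmoothWeakDerivative.
Context {R : realType}.
Local Notation mu := (@lebesgue_measure R).
Local Notation I f := (Rintegral mu setT f).
Local Notation L2 := (L2_on setT).
Implicit Types (f g h r p phi : R -> R) (a b x y e : R).

Lemma ibp_chi p q phi a b : a <= b -> (forall x, is_derive x 1 p (q x)) -> continuous q ->
  test_fun phi ->
  I (fun x => (p x * derive1 phi x + q x * phi x) * chi a b x) = p b * phi b - p a * phi a.
Proof.
move=> ab Dp cq tphi.
have cp : continuous p by apply: derivable_continuous => x; exact: ex_derive.
have cphi := test_continuous tphi; have cphi' := test_continuous (test_derive tphi).
have D x : is_derive x 1 (fun y => p y * phi y) (p x * derive1 phi x + q x * phi x).
  rewrite addrC; apply: is_derive1_mul => //.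
  exact/derivable_is_derive1/(tphi.1 0%N).
apply: (FTC_chi ab _ D) => x.
by apply: cvgD; apply: cvgM; [exact: cp|exact: cphi'|exact: cq|exact: cphi].
Qed.

Lemma test_support phi : test_fun phi ->
  exists2 M, 0 < M & forall x, M < `|x| -> phi x = 0 /\ derive1 phi x = 0.
Proof.
move=> tphi; have [_ [M HM]] := tphi; have [_ [N HN]] := test_derive tphi.
exists (Num.max 1 (Num.max M N)); first by rewrite lt_max ltr01.
by move=> x; rewrite !gt_max => /and3P[_ /HM ? /HN].
Qed.

(** Integrate by parts over an interval whose ends lie strictly outside the support of the test
    function. This is meant for [vbar], which is not in H^1. *)
Lemma C1_weak_deriv p : (forall x, derivable p x 1) -> continuous (derive1 p) ->
  is_weak_deriv p (derive1 p).
Proof.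
move=> dp cp'; have cp := derivable_continuous dp.
have lp := loc_integrable_continuous cp; have lp' := loc_integrable_continuous cp'.
apply/is_weak_derivP => // phi tphi.
have [M M0 HM] := test_support tphi.
have ab : - (M + 1) <= M + 1 by lra.
have := ibp_chi ab (fun x => derivable_is_derive1 (dp x)) cp' tphi.
have [-> _] := HM (M + 1) ltac:(rewrite ger0_norm; lra).
have [-> _] := HM (- (M + 1)) ltac:(rewrite normrN ger0_norm; lra).
rewrite !mulr0 subrr => H; apply/eqP; rewrite -subr_eq0 opprK -H; apply/eqP.
rewrite -RintegralD//; last 2 first.
  by apply: intg_mul_test; [exact: lp|exact: test_derive].
  by apply: intg_mul_test; [exact: lp'|exact: tphi].
apply: eq_Rintegral => x _; rewrite chiE.
have [_|xM] := boolP (- (M + 1) <= x < M + 1); first by rewrite mulr1.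
have [-> ->] : phi x = 0 /\ derive1 phi x = 0; last by rewrite !mulr0 addr0.
apply: HM; rewrite ltNge; apply: contra xM; rewrite ler_norml => /andP[? ?].
by apply/andP; split; lra.
Qed.

End SmoothWeakDerivative.

Section Admissible.
Context {R : realType}.
Local Notation mu := (@lebesgue_measure R).
Local Notation I f := (Rintegral mu setT f).
Local Notation L2 := (L2_on setT).
Variable vbar : R -> R.
Hypothesis Hv : vbar_hyp vbar.

Definition arep (xi : R -> R) x : R := rep (fun x => xi x - vbar x) x + vbar x.

Lemma vbar_weak_deriv : is_weak_deriv vbar (derive1 vbar).
Proof. by have [d [c _]] := Hv; apply: C1_weak_deriv; [exact: d|exact: c]. Qed.

Lemma vbar_L2 : L2 (derive1 vbar).
Proof. by have [_ [_ [_ [_ [_ [_ [_ [_ [_ [_ H]]]]]]]]]] := Hv. Qed.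

Lemma vbar_continuous : continuous vbar.
Proof. by have [d _] := Hv; exact: derivable_continuous. Qed.

Lemma vbar_primitive : primitive_of (derive1 vbar) vbar.
Proof.
move=> a b ab; have [d [c _]] := Hv; symmetry; apply: FTC_chi => // x.
exact: derivable_is_derive1.
Qed.

Lemma primitive_ae (g h r : R -> R) : measurable_fun setT g -> measurable_fun setT h ->
  {ae mu, forall x, g x = h x} -> primitive_of g r -> primitive_of h r.
Proof.
move=> mg mh gh pr a b ab; rewrite pr//; apply: I_ae.
- by apply: measurable_funM => //; exact: measurable_chi.
- by apply: measurable_funM => //; exact: measurable_chi.
- by apply: ae1 gh => x ->.
Qed.

(** [wderiv xi] and [wderiv u] are independent choices and are related only almost everywhere. The
    link is the explicit weak derivative of [xi], the sum of [wderiv u] and the derivative of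
    [vbar]. *)
Lemma adm_spec xi : adm vbar xi -> let u := fun x => xi x - vbar x in
  [/\ is_weak_deriv xi (wderiv xi) /\ L2 (wderiv xi),
      continuous (arep xi), {ae mu, forall x, xi x = arep xi x},
      primitive_of (wderiv xi) (arep xi) &
      {ae mu, forall x, wderiv xi x = wderiv u x + derive1 vbar x}].
Proof.
move=> Hu u; have [cr ur pr] := rep_spec Hu; have Lu := H1_wderiv_L2 Hu.
have Hxi : is_weak_deriv xi (fun x => 1 * wderiv u x + 1 * derive1 vbar x).
  have := is_weak_deriv_lin 1 1 (H1_wderiv Hu) vbar_weak_deriv.
  by rewrite (_ : (fun x => 1 * _ + _) = xi)//; apply/funext => x; ring.
have Lxi := L2_lin 1 1 Lu vbar_L2.
have ae0 := wderiv_ae Hxi; have Hw := wderiv_spec Hxi.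
have mw : measurable_fun setT (wderiv xi) by have [_ [[]]] := Hw.
have ae0' : {ae mu, forall x, 1 * wderiv u x + 1 * derive1 vbar x = wderiv xi x}.
  by apply: ae1 ae0.
split.
- by split => //; exact: L2_ae Lxi.
- by move=> x; apply: cvgD; [exact: cr|exact: vbar_continuous].
- by apply: ae1 ur => x ux; rewrite /arep -ux subrK.
- apply: (primitive_ae Lxi.1 mw ae0') => a b ab.
  transitivity (1 * I (fun x => wderiv u x * chi a b x) + 1 * I (fun x => derive1 vbar x * chi a b x)).
    by rewrite -pr// -vbar_primitive// /arep; ring.
  rewrite -I_lin; last 2 first.
    by apply: intg_mul_chi; exact: L2_loc.
    by apply: intg_mul_chi; apply: L2_loc; exact: vbar_L2.
  by apply: eq_Rintegral => x _; ring.
- by apply: ae1 ae0 => x ->; rewrite !mul1r.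
Qed.

Variable w : R -> R.
Hypothesis Hw : w_hyp w.

Lemma w_continuous : continuous w.
Proof. by have [d _] := Hw; apply: derivable_continuous => x; exact: (d 0%N x isT). Qed.

Lemma w_ge0 x : 0 <= w x.
Proof.
have [_ [_ [_ [w0 [wpos _]]]]] := Hw.
have [[z ->]|H] := pselect (exists z : int, x = z%:~R); first by rewrite w0.
by apply/ltW/wpos => z; apply: contra_notN H => /eqP ->; exists z.
Qed.

Lemma measurable_w (f : R -> R) : measurable_fun setT f -> measurable_fun setT (fun x => w (f x)).
Proof.
by move=> mf; apply: measurableT_comp mf; apply: continuous_measurable_fun; exact: w_continuous.
Qed.

Lemma energy_arep xi : adm vbar xi ->
  energy w xi = ((I (fun x => wderiv xi x ^+ 2))%:E + \int[mu]_x (w (arep xi x))%:E)%E.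
Proof.
move=> Hxi; have [[[[mxi _] _] Lw] cr ae0 _ _] := adm_spec Hxi.
have mr := continuous_measurable_fun cr.
rewrite /energy -EFin_I; last exact: Lw.2.
congr (_ + _)%E; apply: ae_eq_integral => //.
- by apply/measurable_EFinP; exact: measurable_w.
- by apply/measurable_EFinP; exact: measurable_w.
- by apply: ae1 ae0 => x -> _.
Qed.

Lemma Fen_lsc (xis : R -> R) (xi : nat -> R -> R) :
  adm vbar xis -> (forall n, adm vbar (xi n)) -> A_weak_cvg vbar xi xis ->
  (energy w xis <= limn_einf (fun n => energy w (xi n)))%E.
Proof.
move=> As An [_ [_ Hcvg]].
have [[_ Lh] cs _ _ aes] := adm_spec As.
set h := wderiv xis in Lh aes *.
pose u n x := xi n x - vbar x; pose us x := xis x - vbar x.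
pose P f := I (fun x => h x * wderiv f x).
pose H := I (fun x => h x ^+ 2).
(* The integral of h^2 + 2 h (h_n - h), with h_n - h written as the difference of the weak
   derivatives of [u n] and [us]; in this form it is governed by the H^1 functional [P]. *)
pose b n := H + 2 * (P (u n) - P us).
have bH : b @ \oo --> H.
  rewrite -[X in _ --> X]addr0 -[X in _ --> _ + X](mulr0 2) -(subrr (P us)).
  apply: cvgD; first exact: cvg_cst.
  apply: cvgMr; apply: cvgB; last exact: cvg_cst.
  exact: (Hcvg _ (pairing_dual Lh)).
rewrite energy_arep// -/h -/H.
have Hb n : (((b n)%:E + \int[mu]_x (w (arep (xi n) x))%:E) <= energy w (xi n))%E.
  rewrite energy_arep// leeD2r// lee_fin.
  have [[_ Lhn] _ _ _ aen] := adm_spec (An n).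
  have Lu := H1_wderiv_L2 (An n); have Lus := H1_wderiv_L2 As.
  set hn := wderiv (xi n) in Lhn aen *.
  have Ih := Lh.2; have Ihhn := L2_mul Lh (L2B Lhn Lh).
  have -> : b n = 1 * H + 2 * I (fun x => h x * (hn x - h x)).
    rewrite mul1r /b; congr (_ + 2 * _).
    rewrite /P -IB; [|exact: L2_mul|exact: L2_mul].
    apply: I_ae.
    - by apply: intg_measurable; apply: intgB; exact: L2_mul.
    - exact: intg_measurable.
    - by apply: ae2 aen aes => x -> ->; ring.
  rewrite -I_lin//; apply: I_le; [exact: intg_lin|exact: Lhn.2|move=> x].
  by have := sqr_ge0 (hn x - h x); nra.
apply: le_trans; last first.
  by apply: le_limn_einf_near; apply: nearW; exact: Hb.
apply: le_trans; last exact: limn_einfD_cvg bH.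
rewrite leeD2l//.
apply: (@le_trans _ _ (\int[mu]_x limn_einf (fun n => (w (arep (xi n) x))%:E))%E); last first.
  apply: (@fatou _ _ _ mu setT measurableT (fun n x => (w (arep (xi n) x))%:E)).
  - move=> n; apply/measurable_EFinP; apply: measurable_w.
    by have [_ c _ _ _] := adm_spec (An n); exact: continuous_measurable_fun.
  - by move=> n x _; rewrite lee_fin w_ge0.
rewrite le_eqVlt; apply/orP; left; apply/eqP; apply: eq_integral => x _.
have C : (fun n => (w (arep (xi n) x))%:E) @ \oo --> (w (arep xis x))%:E.
  apply: cvg_EFin; first exact: nearW.
  apply: (cvg_comp (fun n => arep (xi n) x) w); last exact: w_continuous.
  apply: cvgD; last exact: cvg_cst.
  exact: (Hcvg _ (eval_dual x)).
by rewrite (cvg_limn_einf_sup C).1.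
Qed.

End Admissible.

(** * Piecewise affine interpolation *)


Section Interpolation.
Context {R : realType}.
Local Notation mu := (@lebesgue_measure R).
Local Notation I f := (Rintegral mu setT f).
Local Notation L2 := (L2_on setT).
Implicit Types (f g h r p phi : R -> R) (a b x y e : R) (i j : int).
Variables (d : R).
Hypothesis d0 : 0 < d.

Definition node i : R := i%:~R * d.
Definition idx x : int := Num.floor (x / d).

Lemma nodeS i : node (i + 1) = node i + d.
Proof. by rewrite /node intrD mulrDl mul1r. Qed.

Lemma idx_itv x : node (idx x) <= x < node (idx x) + d.
Proof.
rewrite -nodeS /node -ler_pdivlMr// -ltr_pdivrMr//.
exact: floor_itv.
Qed.

Lemma idx_eq i x : node i <= x < node i + d -> idx x = i.
Proof.
rewrite -nodeS /node -ler_pdivlMr// -ltr_pdivrMr// => H.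
exact: floor_def.
Qed.

Definition cell i : R -> R := chi (node i) (node i + d).

Lemma cellE i x : cell i x = (idx x == i)%:R.
Proof.
rewrite /cell chiE; congr (nat_of_bool _)%:R.
apply/idP/eqP => [/idx_eq//|<-]; exact: idx_itv.
Qed.

Lemma le_nodeS i : node i <= node i + d.
Proof. by rewrite lerDl ltW. Qed.

(* The cells, enumerated by [nat] through the countability of [int]. *)
Definition cell_set (k : nat) : set R :=
  if pickle_inv k is Some i then `[node i, node i + d[ else set0.

Lemma cell_setP k x : cell_set k x <-> pickle (idx x) = k.
Proof.
rewrite /cell_set; case E : (pickle_inv k) => [i|].
  rewrite /= in_itv/=; split=> [/idx_eq ->|kE].
    by have := @pickle_invK int k; rewrite E.
  by move: E; rewrite -kE pickleK_inv => -[<-]; exact: idx_itv.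
by split => // kE; move: E; rewrite -kE pickleK_inv.
Qed.

Lemma measurable_cell_set k : measurable (cell_set k).
Proof. by rewrite /cell_set; case: pickle_inv. Qed.

Lemma ge0_integral_cells f : measurable_fun setT f -> (forall x, 0 <= f x) ->
  (\int[mu]_x (f x)%:E = \sum_(0 <= k <oo) \int[mu]_(x in cell_set k) (f x)%:E)%E.
Proof.
move=> mf f0.
have <- : \bigcup_k cell_set k = setT.
  rewrite -subTset => x _; exists (pickle (idx x)) => [//|].
  by rewrite (cell_setP (pickle (idx x)) x).
apply: ge0_integral_bigcup.
- exact: measurable_cell_set.
- by apply/measurable_EFinP; exact: measurable_funTS.
- by move=> x _; rewrite lee_fin.
- by apply/trivIsetP => k l _ _ kl; apply/seteqP; split => // x [/cell_setP kx /cell_setP lx];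
    move: kl; rewrite -kx -lx eqxx.
Qed.

Lemma integral_cell_set f k i : pickle_inv k = Some i -> intg (fun x => f x * cell i x) ->
  (\int[mu]_(x in cell_set k) (f x)%:E = (I (fun x => f x * cell i x))%:E)%E.
Proof.
move=> ki If; rewrite -EFin_I// integral_mkcond; apply: eq_integral => x _.
rewrite /cell_set ki patchE mem_setE in_itv/= /cell chiE.
by case: (_ <= _ < _); rewrite ?mulr1 ?mulr0.
Qed.

(** Countable additivity turns cellwise comparison into a global one. Integrability of [f] is a
    result: its integral is first bounded as an extended number. *)
Lemma cells_le f g : measurable_fun setT f -> (forall x, 0 <= f x) ->
  intg g -> (forall x, 0 <= g x) ->
  (forall i, intg (fun x => f x * cell i x)) ->
  (forall i, I (fun x => f x * cell i x) <= I (fun x => g x * cell i x)) ->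
  intg f /\ I f <= I g.
Proof.
move=> mf f0 Ig g0 If fg.
have Ig' i : intg (fun x => g x * cell i x).
  by apply: (intg_mul_bounded (C := 1)) => //; [exact: measurable_chi|move=> x; exact: chi_norm].
have H : (\int[mu]_x (f x)%:E <= \int[mu]_x (g x)%:E)%E.
  rewrite !ge0_integral_cells//; last exact: intg_measurable.
  apply: lee_nneseries => [k _ _|k _]; first by apply: integral_ge0 => x _; rewrite lee_fin.
  case E : (pickle_inv k) => [i|]; last by rewrite /cell_set E !integral_set0.
  by rewrite !(integral_cell_set E)// lee_fin.
have If' : intg f.
  apply/integrableP; split; first exact/measurable_EFinP.
  rewrite (_ : integral _ _ _ = \int[mu]_x (f x)%:E)%E.
    by rewrite (le_lt_trans H)// EFin_I// ltry.
  by apply: eq_integral => x _; rewrite /= ger0_norm.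
by split => //; rewrite -lee_fin -!EFin_I.
Qed.

Variables (xi h : R -> R).
Hypotheses (Lh : L2 h) (xih : primitive_of h xi).

Definition slope i : R := (xi (node i + d) - xi (node i)) / d.
Definition interp x : R := xi (node (idx x)) + slope (idx x) * (x - node (idx x)).
Definition interp_deriv x : R := slope (idx x).

(** Valid on the closed cell: at the right node [idx] already jumps to [i + 1], but the two affine
    pieces agree there. *)
Lemma interp_cell i x : node i <= x <= node i + d ->
  interp x = xi (node i) + slope i * (x - node i).
Proof.
move=> /andP[x1]; rewrite le_eqVlt => /predU1P[->|x2]; last first.
  by rewrite /interp (@idx_eq i) ?x1.
have -> : interp (node i + d) = xi (node i + d).
  by rewrite /interp (@idx_eq (i + 1)) nodeS ?lexx ?ltrDl// subrr mulr0 addr0.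
by rewrite addrAC subrr add0r /slope divfK ?lt0r_neq0// subrKC.
Qed.

Lemma interp_lip i x y : node i <= x <= node i + d -> node i <= y <= node i + d ->
  `|interp x - interp y| = `|slope i| * `|x - y|.
Proof.
by move=> xi' yi; rewrite (interp_cell xi') (interp_cell yi) -normrM; congr `|_|; ring.
Qed.

Lemma interp_continuous : continuous interp.
Proof.
move=> x; apply/cvgrPdist_le => e e0.
(* [x] may be a node, so nearby points can fall into its own cell or the previous one; [K] dominates
   both slopes. *)
set i := idx x; pose j := i - 1; have ij : node i = node j + d by rewrite -nodeS /j subrK.
have /andP[x1 x2] := idx_itv x; rewrite -/i in x1 x2.
pose K := `|slope i| + `|slope j| + 1.
have K0 : 0 < K by rewrite /K; have := normr_ge0 (slope i); have := normr_ge0 (slope j); lra.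
near=> y.
have xy : `|x - y| <= e / K.
  by near: y; apply: (@cvgr_dist_le _ _ _ _ _ id x) => //; rewrite divr_gt0.
have y1 : node j < y.
  by near: y; apply: lt_nbhsr; rewrite (lt_le_trans _ x1)// ij ltrDl.
have y2 : y < node i + d by near: y; exact: lt_nbhsl.
apply: (@le_trans _ _ (K * `|x - y|)); last by rewrite mulrC -ler_pdivlMr.
have si := normr_ge0 (slope i); have sj := normr_ge0 (slope j).
have [iy|yi] := leP (node i) y.
  rewrite (@interp_lip i) ?x1 ?iy ?(ltW x2) ?(ltW y2)// ler_wpM2r// /K; lra.
have -> : interp x - interp y = (interp x - interp (node i)) + (interp (node i) - interp y) by ring.
rewrite (le_trans (ler_normD _ _))// (@interp_lip i) ?x1 ?lexx ?le_nodeS ?(ltW x2)//.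
rewrite (@interp_lip j) -?ij ?lexx ?(ltW y1) ?(ltW yi)//; last by rewrite ij le_nodeS.
have -> : `|x - node i| = x - node i by rewrite ger0_norm// subr_ge0.
have -> : `|node i - y| = node i - y by rewrite ger0_norm// subr_ge0 ltW.
have -> : `|x - y| = x - y by rewrite ger0_norm// subr_ge0; lra.
have h1 : 0 <= `|slope i| * (node i - y) by rewrite mulr_ge0//; lra.
have h2 : 0 <= `|slope j| * (x - node i) by rewrite mulr_ge0//; lra.
rewrite /K; nra.
Unshelve. all: by end_near. Qed.

Lemma xi_continuous : continuous xi.
Proof. exact: primitive_continuous Lh xih. Qed.

Lemma measurable_interp_deriv : measurable_fun setT interp_deriv.
Proof.
have mxi := continuous_measurable_fun xi_continuous.
have mN : measurable_fun setT (fun x => node (idx x)).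
  apply: nondecreasing_measurable => // x y xy.
  rewrite /node ler_wpM2r ?(ltW d0)// ler_int; apply: le_floor.
  by rewrite ler_wpM2r// invr_ge0 ltW.
rewrite /interp_deriv /slope; apply: measurable_funM => //.
apply: measurable_funB; last exact: measurableT_comp mxi mN.
by apply: (measurableT_comp mxi); exact: measurable_funD.
Qed.

Lemma interp_deriv_cell i : (fun x => interp_deriv x ^+ 2 * cell i x) = (fun x => slope i ^+ 2 * cell i x).
Proof.
apply/funext => x; rewrite cellE /interp_deriv.
by have [->//|_] := eqVneq (idx x) i; rewrite !mulr0.
Qed.

Lemma I_cell i : I (cell i) = d.
Proof. by rewrite I_chi ?le_nodeS// addrAC subrr add0r. Qed.

Lemma increment_sqr i :
  (xi (node i + d) - xi (node i)) ^+ 2 <= d * I (fun x => h x ^+ 2 * cell i x).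
Proof.
by have := primitive_sqr Lh xih (le_nodeS i); rewrite addrAC subrr add0r.
Qed.

Lemma interp_deriv_L2 :
  L2 interp_deriv /\ I (fun x => interp_deriv x ^+ 2) <= I (fun x => h x ^+ 2).
Proof.
have [] := @cells_le (fun x => interp_deriv x ^+ 2) (fun x => h x ^+ 2).
- by apply: measurable_funX; exact: measurable_interp_deriv.
- by move=> x; exact: sqr_ge0.
- exact: Lh.2.
- by move=> x; exact: sqr_ge0.
- by move=> i; rewrite interp_deriv_cell; apply: intgZ; exact: intg_chi.
- move=> i; rewrite interp_deriv_cell IZ; last exact: intg_chi.
  rewrite I_cell /slope expr_div_n.
  rewrite (_ : _ / _ * d = (xi (node i + d) - xi (node i)) ^+ 2 / d); last first.
    by field; exact: lt0r_neq0.
  by rewrite ler_pdivrMr// mulrC increment_sqr.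
move=> If H; split => //; split => //; exact: measurable_interp_deriv.
Qed.

(** On a cell, let J be the integral of h^2. Both functions stay within sqrt(d J) of their common
    value at the left node, so the squared distance is at most 4 d J; integration over the length
    [d] yields 4 d^2 J. *)
Lemma interp_dist_L2 : L2 (fun x => interp x - xi x) /\
  I (fun x => (interp x - xi x) ^+ 2) <= 4 * d ^+ 2 * I (fun x => h x ^+ 2).
Proof.
have md : measurable_fun setT (fun x => interp x - xi x).
  apply: measurable_funB; apply: continuous_measurable_fun; first exact: interp_continuous.
  exact: xi_continuous.
pose J i := I (fun x => h x ^+ 2 * cell i x).
have J0 i : 0 <= J i.
  by apply: I_ge0 => x; rewrite mulr_ge0 ?sqr_ge0//; have /andP[] := chi_itv01 (node i) (node i + d) x.
have ptw i x : (interp x - xi x) ^+ 2 * cell i x <= 4 * d * J i * cell i x.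
  rewrite cellE; have [xi_|_] := eqVneq (idx x) i; last by rewrite !mulr0.
  rewrite !mulr1; have := idx_itv x; rewrite xi_ => /andP[x1 x2].
  have -> : interp x = xi (node i) + slope i * (x - node i) by rewrite /interp xi_.
  have A1 : (xi x - xi (node i)) ^+ 2 <= d * J i.
    rewrite (le_trans (primitive_sqr Lh xih x1))//.
    apply: ler_pM; [by rewrite subr_ge0| |lra|].
      by apply: I_ge0 => z; rewrite mulr_ge0 ?sqr_ge0//; have /andP[] := chi_itv01 (node i) x z.
    apply: I_le; [exact: intg_sqr_chi|exact: intg_sqr_chi|move=> z].
    rewrite ler_wpM2l ?sqr_ge0// /cell (chi_split z x1 (ltW x2)) lerDl.
    by have /andP[] := chi_itv01 x (node i + d) z.
  have A2 : (slope i * (x - node i)) ^+ 2 <= d * J i.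
    apply: le_trans (increment_sqr i).
    have -> : xi (node i + d) - xi (node i) = slope i * d by rewrite /slope divfK// lt0r_neq0.
    rewrite (exprMn 2 (slope i) d) (exprMn 2 (slope i)); apply: ler_wpM2l; first exact: sqr_ge0.
    by rewrite (@ler_pXn2r _ 2)// ?nnegrE; lra.
  have := sqr_ge0 ((slope i * (x - node i)) + (xi x - xi (node i))); nra.
have [] := @cells_le (fun x => (interp x - xi x) ^+ 2) (fun x => 4 * d ^+ 2 * h x ^+ 2).
- exact: measurable_funX.
- by move=> x; exact: sqr_ge0.
- by apply: intgZ; exact: Lh.2.
- by move=> x; apply: mulr_ge0; [apply: mulr_ge0; [|exact: sqr_ge0]|exact: sqr_ge0].
- move=> i; apply: (intg_dom _ (intgZ (4 * d * J i) (intg_chi (node i) (node i + d)))).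
    by apply: measurable_funM; [exact: measurable_funX|exact: measurable_chi].
  by move=> x; rewrite ger0_norm ?ptw// mulr_ge0 ?sqr_ge0.
- move=> i; have Ii := intgZ (4 * d * J i) (intg_chi (node i) (node i + d)).
  rewrite (_ : (fun x => 4 * d ^+ 2 * h x ^+ 2 * cell i x) =
               (fun x => 4 * d ^+ 2 * (h x ^+ 2 * cell i x))); last first.
    by apply/funext => x; rewrite mulrA.
  rewrite IZ; last exact: intg_sqr_chi.
  rewrite -/(J i).
  have <- : I (fun x => 4 * d * J i * cell i x) = 4 * d ^+ 2 * J i.
    by rewrite IZ ?I_cell; [ring|exact: intg_chi].
  apply: I_le; [|exact: Ii|exact: ptw].
  apply: (intg_dom _ Ii); first by apply: measurable_funM; [exact: measurable_funX|exact: measurable_chi].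
  by move=> x; rewrite ger0_norm ?ptw// mulr_ge0 ?sqr_ge0.
move=> If H; split => //.
by rewrite (le_trans H)// IZ//; exact: Lh.2.
Qed.

(** Induction over consecutive cells: on each one the interpolant is affine, and the boundary terms
    telescope because neighbouring pieces match at the nodes. *)
Lemma interp_ibp phi i (m : nat) : test_fun phi ->
  I (fun x => (interp x * derive1 phi x + interp_deriv x * phi x) * chi (node i) (node i + m%:R * d) x) =
  interp (node i + m%:R * d) * phi (node i + m%:R * d) - interp (node i) * phi (node i).
Proof.
move=> tphi; have tphi' := test_derive tphi.
have li := loc_integrable_continuous interp_continuous.
have ld := L2_loc interp_deriv_L2.1.
pose F x := interp x * derive1 phi x + interp_deriv x * phi x.
have IF : intg F by apply: intgD; exact: intg_mul_test.
have IFc a b : intg (fun x => F x * chi a b x).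
  by apply: (intg_mul_bounded (C := 1)) => //; [exact: measurable_chi|move=> x; exact: chi_norm].
elim: m => [|m IH].
  rewrite mul0r addr0 subrr -[RHS]I0; apply: eq_Rintegral => x _.
  by rewrite chiE leNgt; case: ltP; rewrite ?mulr0.
have N1 : node i + m%:R * d = node (i + m) by rewrite /node intrD mulrDl.
have N2 : node i + m.+1%:R * d = node (i + m) + d by rewrite -N1 mulrSr mulrDl mul1r addrA.
set j := i + m%:Z in N1 N2.
have ij : node i <= node j by rewrite -N1 lerDl mulr_ge0// ltW.
have jj := le_nodeS j.
rewrite N2; rewrite N1 in IH.
transitivity (I (fun x => F x * chi (node i) (node j) x) + I (fun x => F x * cell j x)).
  rewrite -(RintegralD measurableT (IFc (node i) (node j)) (IFc (node j) (node j + d))).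
  by apply: eq_Rintegral => x _; rewrite (chi_split x ij jj) mulrDr.
rewrite IH.
have -> : (fun x => F x * cell j x) =
  (fun x => ((slope j * x + (xi (node j) - slope j * node j)) * derive1 phi x +
    slope j * phi x) * chi (node j) (node j + d) x).
  apply/funext => x; rewrite -/(cell j) cellE; have [jx|_] := eqVneq (idx x) j; last by rewrite !mulr0.
  rewrite /F /interp /interp_deriv jx; ring.
rewrite (ibp_chi jj (fun x => is_derive1_affine (slope j) (xi (node j) - slope j * node j) x) _ tphi); last first.
  by move=> x; exact: cvg_cst.
rewrite (@interp_cell j (node j + d)) ?jj ?lexx// (@interp_cell j (node j)) ?jj ?lexx//.
ring.
Qed.

Lemma interp_weak_deriv : is_weak_deriv interp interp_deriv.
Proof.
have li := loc_integrable_continuous interp_continuous.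
have ld := L2_loc interp_deriv_L2.1.
apply/is_weak_derivP => // phi tphi.
have tphi' := test_derive tphi.
have [M M0 HM] := test_support tphi.
(* With [n d > M], the [2 n] cells starting at the node [- n d] cover the support of the test
   function. *)
pose n := (Num.truncn (M / d)).+1.
have nM : M < n%:R * d by rewrite -ltr_pdivrMr// truncnS_gt.
pose i : int := - n%:Z.
have iE : node i = - (n%:R * d) by rewrite /node /i mulrNz mulNr.
have iE' : node i + (n + n)%:R * d = n%:R * d by rewrite iE natrD mulrDl; ring.
have := interp_ibp i (n + n) tphi; rewrite iE' iE.
have [-> _] := HM (n%:R * d) ltac:(by rewrite ger0_norm// mulr_ge0// ltW).
have [-> _] := HM (- (n%:R * d)) ltac:(by rewrite normrN ger0_norm// mulr_ge0// ltW).
rewrite !mulr0 subrr => H; apply/eqP; rewrite -subr_eq0 opprK -H; apply/eqP.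
rewrite -RintegralD//; last 2 first.
  by apply: intg_mul_test; [exact: li|exact: tphi'].
  by apply: intg_mul_test; [exact: ld|exact: tphi].
apply: eq_Rintegral => x _; rewrite chiE.
have [_|xM] := boolP (- (n%:R * d) <= x < n%:R * d); first by rewrite mulr1.
have [-> ->] : phi x = 0 /\ derive1 phi x = 0; last by rewrite !mulr0 addr0.
apply: HM; rewrite ltNge; apply: contra xM; rewrite ler_norml => /andP[? ?].
by apply/andP; split; lra.
Qed.

Lemma interp_affine i : exists a b, forall x,
  x \in `[(i - 1)%:~R * d, i%:~R * d] -> interp x = a * x + b.
Proof.
exists (slope (i - 1)), (xi (node (i - 1)) - slope (i - 1) * node (i - 1)) => x.
rewrite in_itv/= -/(node _) -/(node _) -{2}(subrK 1 i) nodeS => /interp_cell ->; ring.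
Qed.

End Interpolation.

(** * Bounds on the potential and strong convergence *)


Section PotentialBounds.
Context {R : realType}.
Implicit Types (f g w : R -> R) (a b x y e : R).

(** The location of [c] is expressed by distances to [b], which treats both orders of [a] and [b] at
    once. *)
Lemma mvt_between f g a b : (forall x, is_derive x 1 f (g x)) ->
  exists2 c, `|c - b| <= `|a - b| & f a - f b = g c * (a - b).
Proof.
move=> Df; have cf : continuous f by apply: derivable_continuous => x; exact: ex_derive.
have [ab|/ltW ba] := leP a b.
  have [c /[!in_itv]/= /andP[c1 c2] H] := MVT_segment ab (fun x _ => Df x) (continuous_subspaceT cf).
  exists c; last by rewrite -opprB H; ring.
  by rewrite !ler0_norm ?subr_le0//; lra.
have [c /[!in_itv]/= /andP[c1 c2] H] := MVT_segment ba (fun x _ => Df x) (continuous_subspaceT cf).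
by exists c => //; rewrite !ger0_norm ?subr_ge0//; lra.
Qed.

Lemma derive1_periodic f : (forall x, f (x + 1) = f x) ->
  forall x, derive1 f (x + 1) = derive1 f x.
Proof.
move=> fp x; rewrite /derive1.
rewrite (_ : (fun h => h^-1 *: (f (h + (x + 1)) - f (x + 1))) =
             (fun h => h^-1 *: (f (h + x) - f x)))//.
by apply/funext => t; rewrite addrA !fp.
Qed.

Lemma periodic_bounded f : (forall x, f (x + 1) = f x) -> continuous f ->
  exists2 M, 0 < M & forall x, `|f x| <= M.
Proof.
move=> fp cf.
have fpn (n : nat) x : f (x + n%:R) = f x.
  by elim: n => [|n IH]; rewrite ?addr0// -natr1 addrA fp.
have cpt : compact (f @` `[0, 1]).
  by apply: continuous_compact; [exact: continuous_subspaceT|exact: segment_compact].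
have [B [_ HB]] := compact_bounded cpt.
exists (`|B| + 1); first by rewrite ltr_wpDl.
move=> x; have /andP[x1 x2] := floor_itv x.
have x01 : (f @` `[0, 1]) (f x).
  exists (x - (Num.floor x)%:~R).
    by rewrite /= in_itv/=; move: x2; rewrite intrD => x2; apply/andP; split; lra.
  case: (Num.floor x) => n.
    by rewrite -[in RHS](subrK n%:R x) fpn.
  by rewrite NegzE mulrNz opprK fpn.
by apply: (HB (`|B| + 1)) => //; have := ler_norm B; lra.
Qed.

Lemma w_quadratic w : w_hyp w -> exists2 M, 0 < M &
  forall e a b, 0 < e -> w a <= (1 + e * M) * w b + (e^-1 + M) * (a - b) ^+ 2.
Proof.
move=> Hw; have [dw [_ [wp _]]] := Hw.
have D0 x : is_derive x 1 w (derive1 w x) := derivable_is_derive1 (dw 0%N x isT).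
have D1 x : is_derive x 1 (derive1 w) (derive1 (derive1 w) x) :=
  derivable_is_derive1 (dw 1%N x isT).
have c2 : continuous (derive1 (derive1 w)).
  by apply: derivable_continuous => x; exact: (dw 2%N x isT).
have [M M0 HM] := periodic_bounded (derive1_periodic (derive1_periodic wp)) c2.
(* Two applications of the mean value theorem yield the constant [M], rather than the M/2 of
   Taylor's formula. *)
have T a b : w a <= w b + derive1 w b * (a - b) + M * (a - b) ^+ 2.
  have [c c1 Hc] := mvt_between a b D0.
  have [d _ Hd] := mvt_between c b D1.
  have E : w a = w b + derive1 w c * (a - b) by rewrite -Hc; ring.
  rewrite -subr_ge0 E (_ : _ - _ = M * (a - b) ^+ 2 - (derive1 w c - derive1 w b) * (a - b)); last by ring.
  rewrite subr_ge0 (le_trans (ler_norm _))// Hd !normrM -real_normK ?num_real// expr2 mulrA.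
  by rewrite ler_wpM2r// ler_pM.
(* Since w >= 0, the quadratic upper bound [T] is nonnegative at its minimum, a = b - w'(b) /
   (2M). *)
have S b : derive1 w b ^+ 2 <= 4 * M * w b.
  have H := le_trans (w_ge0 Hw (b - derive1 w b / (2 * M))) (T _ b).
  have M1 := lt0r_neq0 M0.
  have E : w b + derive1 w b * (b - derive1 w b / (2 * M) - b) +
    M * (b - derive1 w b / (2 * M) - b) ^+ 2 = w b - derive1 w b ^+ 2 / (4 * M).
    by field.
  rewrite E subr_ge0 ler_pdivrMr in H; last by rewrite mulr_gt0.
  by rewrite mulrC.
exists M => // e a b e0; apply: le_trans (T a b) _.
have e1 := lt0r_neq0 e0.
(* Young's inequality with weight [e]; the factor 1/4 cancels the 4 in [S]. *)
have Y : derive1 w b * (a - b) <= e * derive1 w b ^+ 2 / 4 + e^-1 * (a - b) ^+ 2.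
  rewrite -subr_ge0 (_ : _ - _ = (e * derive1 w b / 2 - (a - b)) ^+ 2 / e); last by field.
  by rewrite divr_ge0 ?sqr_ge0// ltW.
have := ler_wpM2l (ltW e0) (S b).
move: Y; move: (e^-1) (derive1 w b) => ? ?; nra.
Qed.

End PotentialBounds.

Section StrongConvergence.
Context {R : realType}.
Local Notation mu := (@lebesgue_measure R).
Local Notation I f := (Rintegral mu setT f).
Local Notation L2 := (L2_on setT).

Lemma limn_einf_ge_near (u : (\bar R)^nat) (l e : R) : (l%:E <= limn_einf u)%E -> 0 < e ->
  \forall n \near \oo, ((l - e)%:E <= u n)%E.
Proof.
move=> lu e0.
have : ((l - e)%:E < ereal_sup (range (einfs u)))%E.
  rewrite -(@cvg_lim _ _ _ _ _ _ _ (@cvg_einfs_sup _ u))// -limn_einf_lim.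
  by apply: lt_le_trans lu; rewrite lte_fin ltrBlDr ltrDl.
move=> /ereal_sup_gt[_ [N _ <-]] H; exists N => // n /= Nn.
apply/ltW/(lt_le_trans H); apply: ereal_inf_lbound; exact: (ex_intro2 _ _ n).
Qed.

(* Fatou's lemma for [(f n + g) ^+ 2], then the parallelogram identity. *)
Lemma L2_cvg_of_ae (f : nat -> R -> R) (g : R -> R) :
  (forall n, L2 (f n)) -> L2 g -> {ae mu, forall x, f ^~ x @ \oo --> g x} ->
  (forall n, I (fun x => f n x ^+ 2) <= I (fun x => g x ^+ 2)) ->
  (fun n => I (fun x => (f n x - g x) ^+ 2)) @ \oo --> (0:R).
Proof.
move=> Lf Lg fg Hle.
set H := I (fun x => g x ^+ 2) in Hle *.
pose F n x := ((f n x + g x) ^+ 2)%:E.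
have LS n : L2 (fun x => f n x + g x).
  by apply: L2_ext (L2_lin 1 1 (Lf n) Lg) => x; rewrite !mul1r.
have LD n := L2B (Lf n) Lg.
have mF n : measurable_fun setT (F n).
  by apply/measurable_EFinP; exact: intg_measurable (LS n).2.
have F0 n x : (0 <= F n x)%E by rewrite lee_fin sqr_ge0.
have key : ((4 * H)%:E <= limn_einf (fun n => (I (fun x => (f n x + g x) ^+ 2))%:E))%E.
  have := @fatou _ _ _ mu setT measurableT F mF (fun n x _ => F0 n x).
  rewrite (_ : (fun n => \int[mu]_x F n x)%E =
     (fun n => (I (fun x => (f n x + g x) ^+ 2))%:E)); last first.
    by apply/funext => n; rewrite EFin_I//; exact: (LS n).2.
  apply: le_trans.
  rewrite -IZ; last exact: Lg.2.
  rewrite -EFin_I; last by apply: intgZ; exact: Lg.2.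
  rewrite le_eqVlt; apply/orP; left; apply/eqP.
  apply: ae_eq_integral => //.
  - by apply/measurable_EFinP; apply: intg_measurable; apply: intgZ; exact: Lg.2.
  - apply: (measurableT_comp (f := -%E)); first exact: oppe_measurable.
    apply: (@measurable_fun_limn_esup _ _ _ setT (fun n x => - F n x)%E) => n.
    by apply: measurableT_comp; [exact: oppe_measurable|exact: mF].
  - apply: ae1 fg => x fx _; symmetry; apply: (fun C => (cvg_limn_einf_sup C).1).
    apply: cvg_EFin; first exact: nearW.
    rewrite (_ : 4 * g x ^+ 2 = (g x + g x) * (g x + g x)); last by ring.
    by apply: cvgM; apply: cvgD => //; exact: cvg_cst.
apply/cvgrPdist_le => e e0.
have := limn_einf_ge_near key e0.
apply: filterS => n; rewrite lee_fin sub0r normrN ger0_norm; last first.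
  by apply: I_ge0 => x; exact: sqr_ge0.
(* The right-hand side is at most 4H, and the second integral on the left is eventually at least 4H
   - e. *)
have : I (fun x => (f n x - g x) ^+ 2) + I (fun x => (f n x + g x) ^+ 2) =
   2 * I (fun x => f n x ^+ 2) + 2 * H.
  rewrite -(I_lin 2 2 (Lf n).2 Lg.2) -RintegralD//; last 2 first.
    exact: (LD n).2.
    exact: (LS n).2.
  by apply: eq_Rintegral => x _; ring.
have := Hle n; lra.
Qed.

End StrongConvergence.

(** * Recovery sequence *)


Section Recovery.
Context {R : realType}.
Local Notation mu := (@lebesgue_measure R).
Local Notation I f := (Rintegral mu setT f).
Local Notation L2 := (L2_on setT).
Variables (w vbar : R -> R) (delta : nat -> R).
Hypotheses (Hw : w_hyp w) (Hv : vbar_hyp vbar).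
Hypotheses (delta_gt0 : forall n, 0 < delta n) (delta_cvg0 : delta @ \oo --> (0:R)).
Variable xis : R -> R.
Hypothesis As : adm vbar xis.

Local Notation h := (wderiv xis).
Local Notation xi := (arep vbar xis).

Let Lh : L2 h. Proof. by have [[]] := adm_spec Hv As. Qed.
Let xih : primitive_of h xi. Proof. by have [] := adm_spec Hv As. Qed.
Let H : R := I (fun x => h x ^+ 2).

Definition recovery n : R -> R := interp (delta n) xi.
Let g n : R -> R := interp_deriv (delta n) xi.
Let Lg n : L2 (g n) := (interp_deriv_L2 (delta_gt0 n) Lh xih).1.
Let Lg_le n : I (fun x => g n x ^+ 2) <= H := (interp_deriv_L2 (delta_gt0 n) Lh xih).2.

Lemma recovery_weak_deriv n : is_weak_deriv (recovery n) (g n).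
Proof. exact: interp_weak_deriv Lh xih. Qed.

Lemma measurable_recovery n : measurable_fun setT (recovery n).
Proof. by apply: continuous_measurable_fun; exact: interp_continuous. Qed.

Lemma arep_sub_L2 : L2 (fun x => xi x - vbar x).
Proof.
have [_ c a _ _] := adm_spec Hv As.
apply: L2_ae As.1; last by apply: ae1 a => x ->.
apply: measurable_funB; apply: continuous_measurable_fun; [exact: c|exact: vbar_continuous].
Qed.

Lemma recovery_sub_weak_deriv n :
  is_weak_deriv (fun x => recovery n x - vbar x) (fun x => g n x - derive1 vbar x).
Proof.
have := is_weak_deriv_lin 1 (-1) (recovery_weak_deriv n) (vbar_weak_deriv Hv).
rewrite (_ : (fun x => 1 * recovery n x + _) = (fun x => recovery n x - vbar x)); last first.
  by apply/funext => x; rewrite mul1r mulN1r.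
rewrite (_ : (fun x => 1 * g n x + _) = (fun x => g n x - derive1 vbar x))//.
by apply/funext => x; rewrite mul1r mulN1r.
Qed.

Lemma recovery_adm n : adm vbar (recovery n).
Proof.
split; last first.
  exists (fun x => g n x - derive1 vbar x); split; first exact: recovery_sub_weak_deriv.
  by apply: L2B; [exact: Lg|exact: vbar_L2].
have LD := (interp_dist_L2 (delta_gt0 n) Lh xih).1.
by apply: L2_ext (L2_lin 1 1 LD arep_sub_L2) => x; rewrite /recovery; ring.
Qed.

Lemma recovery_adm_delta n : adm_delta vbar (delta n) (recovery n).
Proof.
split; first exact: recovery_adm; split; first exact: interp_continuous.
by move=> i; exact: interp_affine.
Qed.

Lemma recovery_deriv_cvg : (fun n => I (fun x => (g n x - h x) ^+ 2)) @ \oo --> (0:R).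
Proof.
apply: L2_cvg_of_ae => //.
apply: ae1 (ae_lebesgue_pt (L2_loc Lh)) => x hx.
exact: (@slope_cvg _ h xi x (fun n => node (delta n) (idx (delta n) x)) delta (L2_loc Lh) xih hx
  delta_gt0 delta_cvg0 (fun n => idx_itv (delta_gt0 n) x)).
Qed.

Lemma delta_sqr_cvg0 (C : R) : (fun n => C * delta n ^+ 2) @ \oo --> (0:R).
Proof.
rewrite -[X in _ --> X](mulr0 C) -[X in _ --> C * X](mulr0 0); apply: cvgMr.
by rewrite (_ : (fun n => delta n ^+ 2) = (fun n => delta n * delta n)) //; exact: cvgM.
Qed.

(** The difference is written as [-1 * f + g] because this is the shape in which [H1_dual] states
    linearity. *)
Lemma recovery_H1norm_cvg :
  (fun n => H1norm (fun x => -1 * (xis x - vbar x) + (recovery n x - vbar x))) @ \oo --> (0:R).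
Proof.
pose D n x := -1 * (xis x - vbar x) + (recovery n x - vbar x).
have HD n : H1 (D n) by apply: H1_lin => //; exact: recovery_adm.
have [_ cxi aexi _ aeh] := adm_spec Hv As.
have q n : H1norm (D n) ^+ 2 =
    I (fun x => (recovery n x - xi x) ^+ 2) + I (fun x => (g n x - h x) ^+ 2).
  rewrite H1norm_sqr; congr (_ + _); apply: I_ae.
  - exact: intg_measurable (HD n).1.2.
  - exact: intg_measurable (interp_dist_L2 (delta_gt0 n) Lh xih).1.2.
  - by apply: ae1 aexi => x ax; rewrite /D ax; congr (_ ^+ 2); ring.
  - exact: intg_measurable (H1_wderiv_L2 (HD n)).2.
  - exact: intg_measurable (L2B (Lg n) Lh).2.
  - have a2 : {ae mu, forall x,
        wderiv (fun x => recovery n x - vbar x) x = g n x - derive1 vbar x /\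
        h x = wderiv (fun x => xis x - vbar x) x + derive1 vbar x}.
      by apply: ae2 (wderiv_ae (recovery_sub_weak_deriv n)) aeh.
    apply: ae2 (wderiv_lin (-1) As (recovery_adm n)) a2 => x E [E1 E2].
    by rewrite /D E E1 E2; congr (_ ^+ 2); ring.
have qcvg : (fun n => H1norm (D n) ^+ 2) @ \oo --> (0:R).
  rewrite (funext q : (fun n => H1norm (D n) ^+ 2) = _).
  rewrite -[X in _ --> X]addr0; apply: cvgD; last exact: recovery_deriv_cvg.
  apply: (@squeeze_cvgr _ _ _ _ (fun=> 0) (fun n => (4 * H) * delta n ^+ 2)).
  - apply: nearW => n; apply/andP; split; first by apply: I_ge0 => x; exact: sqr_ge0.
    by rewrite (le_trans (interp_dist_L2 (delta_gt0 n) Lh xih).2)// mulrAC.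
  - exact: cvg_cst.
  - exact: delta_sqr_cvg0.
have -> : (fun n => H1norm (D n)) = (fun n => Num.sqrt (H1norm (D n) ^+ 2)).
  by apply/funext => n; rewrite sqrtr_sqr ger0_norm// H1norm_ge0.
rewrite -[X in _ --> X]sqrtr0.
exact: (cvg_comp _ _ qcvg (@sqrt_continuous R 0)).
Qed.

(** Strong convergence suffices: [L] of the difference is bounded by [C] times its H^1 norm. *)
Lemma recovery_weak_cvg : A_weak_cvg vbar recovery xis.
Proof.
split; first exact: recovery_adm; split; first exact: As.
move=> L [Llin [C HC]].
pose u n x := recovery n x - vbar x; pose us x := xis x - vbar x.
pose D n x := -1 * us x + u n x.
have HD n : H1 (D n) by apply: H1_lin => //; exact: recovery_adm.
have LD n : L (u n) = L (D n) + L us by rewrite Llin//; [ring|exact: recovery_adm].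
rewrite (_ : (fun n => _) = (fun n => L (D n) + L us)); last by apply/funext => n; exact: LD.
rewrite -[X in _ --> X]add0r; apply: cvgD; last exact: cvg_cst.
apply/norm_cvg0P.
apply: (@squeeze_cvgr _ _ _ _ (fun=> 0) (fun n => C * H1norm (D n))).
- by apply: nearW => n; rewrite normr_ge0 HC.
- exact: cvg_cst.
- rewrite -[X in _ --> X](mulr0 C); apply: cvgMr; exact: recovery_H1norm_cvg.
Qed.

Lemma recovery_energy n : energy w (recovery n) =
  ((I (fun x => g n x ^+ 2))%:E + \int[mu]_x (w (recovery n x))%:E)%E.
Proof.
rewrite /energy -EFin_I; last exact: (Lg n).2.
congr (_ + _)%E; have Hwd := wderiv_ae (recovery_weak_deriv n).
have [_ [[mw _] _]] := wderiv_spec (recovery_weak_deriv n).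
apply: ae_eq_integral => //.
- by apply/measurable_EFinP; apply: measurable_funX.
- by apply/measurable_EFinP; apply: measurable_funX; exact: (Lg n).1.
- by apply: ae1 Hwd => x -> _.
Qed.

Lemma recovery_limsup :
  (limn_esup (fun n => Eden w vbar (delta n) (recovery n)) <= Fen w xis)%E.
Proof.
rewrite /Fen (energy_arep Hv Hw As) -/H.
have [_ cxi _ _ _] := adm_spec Hv As.
have mwxi : measurable_fun setT (fun x => w (xi x)).
  by apply: measurable_w => //; exact: continuous_measurable_fun.
have W0 : (0 <= \int[mu]_x (w (xi x))%:E)%E.
  by apply: integral_ge0 => x _; rewrite lee_fin w_ge0.
have [->|Wfin] := eqVneq (\int[mu]_x (w (xi x))%:E)%E +oo%E; first by rewrite addeC/= leey.
have Iw : intg (fun x => w (xi x)).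
  apply/integrableP; split; first exact/measurable_EFinP.
  rewrite (_ : integral _ _ _ = \int[mu]_x (w (xi x))%:E)%E; first by rewrite ltey.
  by apply: eq_integral => x _; rewrite /= ger0_norm// w_ge0.
rewrite EFin_I// -EFinD; set W := I (fun x => w (xi x)).
have [M M0 HM] := w_quadratic Hw.
(* The bound from [w_quadratic] with [e] equal to [delta n]. The squared L^2 error 4 delta^2 H
   outweighs the factor 1/delta + M, leaving 4 H (delta + M delta^2), which tends to 0. *)
pose B n := H + ((1 + delta n * M) * W + (4 * H) * (delta n + M * delta n ^+ 2)).
have BHW : B @ \oo --> H + W.
  rewrite (_ : H + W = H + ((1 + 0 * M) * W + (4 * H) * (0 + 0))); last by ring.
  apply: cvgD; first exact: cvg_cst.
  apply: cvgD.
    apply: cvgMl; apply: cvgD; first exact: cvg_cst.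
    exact: cvgMl.
  by apply: cvgMr; apply: cvgD => //; exact: delta_sqr_cvg0.
apply: (@limn_esup_le_cvg_near _ _ (fun n => (B n)%:E)); last first.
  by apply: cvg_EFin; [exact: nearW|exact: BHW].
apply: nearW => n; have dn := delta_gt0 n.
rewrite /Eden asboolT; last exact: recovery_adm_delta.
rewrite recovery_energy /B EFinD leeD ?lee_fin ?Lg_le//.
have [LD LDle] := interp_dist_L2 dn Lh xih.
set c := (delta n)^-1 + M.
have c0 : 0 <= c by rewrite addr_ge0 ?invr_ge0 ?ltW.
apply: (@le_trans _ _ (\int[mu]_x ((1 + delta n * M) * w (xi x) + c * (recovery n x - xi x) ^+ 2)%:E)%E).
  apply: ge0_le_integral => //.
  - by move=> x _; rewrite lee_fin w_ge0.
  - apply/measurable_EFinP; apply: measurable_w => //; exact: measurable_recovery.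
  - apply/measurable_EFinP; apply: intg_measurable; exact: (intg_lin _ _ Iw LD.2).
  - by move=> x _; rewrite lee_fin; exact: HM.
rewrite EFin_I; last exact: (intg_lin _ _ Iw LD.2).
rewrite lee_fin (I_lin _ _ Iw LD.2) lerD2l.
rewrite (le_trans (ler_wpM2l c0 LDle))// -/H le_eqVlt; apply/orP; left; apply/eqP.
by rewrite /c; field; exact: lt0r_neq0.
Qed.

End Recovery.

Theorem theorem3p3 (R : realType) (w vbar : R -> R) (delta : nat -> R) :
  w_hyp w -> vbar_hyp vbar ->
  (forall n, 0 < delta n) -> delta @ \oo --> 0 ->
  (forall (xis : R -> R) (xi : nat -> R -> R),
      adm vbar xis -> (forall n, adm vbar (xi n)) -> A_weak_cvg vbar xi xis ->
      (Fen w xis <= limn_einf (fun n => Eden w vbar (delta n) (xi n)))%E) /\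
  (forall xis : R -> R, adm vbar xis ->
      exists xi : nat -> R -> R,
        (forall n, adm vbar (xi n)) /\ A_weak_cvg vbar xi xis /\
        (limn_esup (fun n => Eden w vbar (delta n) (xi n)) <= Fen w xis)%E).
Proof.
move=> Hw Hv d0 dcvg; split.
  move=> xis xi As An cvgxi; apply: le_trans (Fen_lsc Hv Hw As An cvgxi) _.
  apply: le_limn_einf_near; apply: nearW => n.
  by rewrite /Eden; case: ifPn => _; rewrite ?leey.
move=> xis As; exists (recovery vbar delta xis); split.
  by move=> n; exact: recovery_adm.
by split; [exact: recovery_weak_cvg|exact: recovery_limsup].
Qed.
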